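(* Let $\mathbb K$ be an algebraically closed field of characteristic $p>3$. For each of the Lie superalgebras $\mathfrak g=\mathfrak{sl}(1|2)$, $\mathfrak{osp}(3|2)$, $\mathfrak{osp}(1|4)$ over $\mathbb K$, we have $H^1(\mathfrak g;\mathfrak g)=0$ and $H^2(\mathfrak g)=0$.
   Context: $\mathfrak{sl}(1|2)$ is the Lie superalgebra of supertraceless supermatrices of size $1|2$; $\mathfrak{osp}(m|2n)$ is the Lie superalgebra of supermatrices preserving a non-degenerate even supersymmetric bilinear form on $\mathbb K^{m|2n}$ (symmetric on the even part, antisymmetric on the odd part). $H^1(\mathfrak g;\mathfrak g)$ is the superspace of all (even and odd) derivations modulo inner ones. $H^2(\mathfrak g)$ is the second cohomology with trivial coefficients (both parities): super-antisymmetric bilinear forms $\omega$ with $\omega([x,y],z)=\omega(x,[y,z])-(-1)^{p(x)p(y)}\omega(y,[x,z])$ modulo the forms $f([x,y])$ with $f$ linear. *)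

(* Defs.v *)
From HB Require Import structures.
From mathcomp Require Import all_boot all_order all_algebra.
From mathcomp Require Import ring.

Set Implicit Arguments.
Unset Strict Implicit.
Unset Printing Implicit Defensive.

Import GRing.Theory.
Local Open Scope ring_scope.

(* Parities are booleans: [false] is even, [true] is odd, [a (+) b] is the    *)
(* parity of a product, and [(-1) ^+ (a && b)] is the sign (-1)^(ab).         *)

(* The axioms are the naive ones, which define Lie superalgebras only when    *)
(* the characteristic of K is not 2 or 3 (in characteristic 3 one also asks   *)
(* [x, [x, x]] = 0 for odd x, in characteristic 2 a squaring).                *)
Record lieSuperalgebra (K : fieldType) := LieSuperalgebra {
  lsa_sort :> vectType K;
  lsa_part : bool -> {vspace lsa_sort};
  lsa_br : {bilinear lsa_sort -> lsa_sort -> lsa_sort};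
  lsa_direct : (lsa_part false :&: lsa_part true)%VS = 0%VS;
  lsa_full : (lsa_part false + lsa_part true)%VS = fullv;
  lsa_graded : forall a b x y, x \in lsa_part a -> y \in lsa_part b ->
    lsa_br x y \in lsa_part (a (+) b);
  lsa_anti : forall a b x y, x \in lsa_part a -> y \in lsa_part b ->
    lsa_br x y = - ((-1) ^+ (a && b) *: lsa_br y x);
  lsa_jacobi : forall a b c x y z,
    x \in lsa_part a -> y \in lsa_part b -> z \in lsa_part c ->
    lsa_br x (lsa_br y z)
      = lsa_br (lsa_br x y) z + (-1) ^+ (a && b) *: lsa_br y (lsa_br x z)
}.

Section Cohomology.
Variables (K : fieldType) (g : lieSuperalgebra K).

Definition superderivation (d : bool) (D : {linear g -> g}) : Prop :=
  (forall a (x : g), x \in lsa_part g a -> D x \in lsa_part g (d (+) a)) /\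
  (forall a (x y : g), x \in lsa_part g a ->
     D (lsa_br g x y)
       = lsa_br g (D x) y + (-1) ^+ (d && a) *: lsa_br g x (D y)).

(* H^1(g; g) = 0: in each parity, the quotient of the space of derivations by *)
(* the space of the inner ones is zero.                                       *)
Definition H1_adjoint_eq0 : Prop :=
  forall (d : bool) (D : {linear g -> g}), superderivation d D ->
    exists2 u : g, u \in lsa_part g d & forall x, D x = lsa_br g u x.

(* The conditions do not involve the parity of [w], so that the [w]           *)
(* satisfying them form the whole superspace of even and odd 2-cocycles.      *)
Definition cocycle2 (w : {biscalar g}) : Prop :=
  (forall a b (x y : g), x \in lsa_part g a -> y \in lsa_part g b ->
     w x y = - ((-1) ^+ (a && b) * w y x)) /\
  (forall a b (x y z : g), x \in lsa_part g a -> y \in lsa_part g b ->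
     w (lsa_br g x y) z
       = w x (lsa_br g y z) - (-1) ^+ (a && b) * w y (lsa_br g x z)).

Definition H2_trivial_eq0 : Prop :=
  forall w : {biscalar g}, cocycle2 w ->
    exists f : {scalar g}, forall x y, w x y = f (lsa_br g x y).

End Cohomology.

Section SubLieSuperalgebra.
Variables (K : fieldType) (g : lieSuperalgebra K) (U : {vspace g}).
Hypothesis U_graded :
  (U <= U :&: lsa_part g false + U :&: lsa_part g true)%VS.
Hypothesis U_br : forall x y, x \in U -> y \in U -> lsa_br g x y \in U.

Definition sub_part (a : bool) : {vspace subvs_of U} :=
  (linfun (vsval : subvs_of U -> g) @^-1: lsa_part g a)%VS.

Definition sub_br (u v : subvs_of U) : subvs_of U :=
  vsproj U (lsa_br g (vsval u) (vsval v)).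

Lemma mem_sub_part a u : (u \in sub_part a) = (vsval u \in lsa_part g a).
Proof. by rewrite -memv_preim lfunE. Qed.

Lemma val_sub_br u v : vsval (sub_br u v) = lsa_br g (vsval u) (vsval v).
Proof. by rewrite vsprojK // U_br // subvsP. Qed.

Lemma sub_br_bilinear : bilinear_for *:%R *:%R sub_br.
Proof.
split=> u k x y; rewrite /sub_br /=.
  by rewrite linearPl linearP.
by rewrite linearPr linearP.
Qed.

HB.instance Definition _ :=
  bilinear_isBilinear.Build K (subvs_of U) (subvs_of U) (subvs_of U)
    *:%R *:%R sub_br sub_br_bilinear.

Lemma sub_direct : (sub_part false :&: sub_part true)%VS = 0%VS.
Proof.
apply/eqP; rewrite -subv0; apply/subvP => u.
rewrite memv_cap !mem_sub_part memv0 => /andP[u0 u1]; apply/eqP/val_inj => /=.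
have : vsval u \in (lsa_part g false :&: lsa_part g true)%VS.
  by rewrite memv_cap u0 u1.
by rewrite lsa_direct memv0 => /eqP.
Qed.

Lemma sub_full : (sub_part false + sub_part true)%VS = fullv.
Proof.
apply/eqP; rewrite eqEsubv subvf /=; apply/subvP => u _.
have /(subvP U_graded)/memv_addP[x + [y + uE]] := subvsP u.
rewrite !memv_cap => /andP[xU x0] /andP[yU y1].
apply/memv_addP; exists (vsproj U x); first by rewrite mem_sub_part vsprojK.
exists (vsproj U y); first by rewrite mem_sub_part vsprojK.
by apply: val_inj; rewrite /= !vsprojK.
Qed.

Lemma sub_graded a b u v : u \in sub_part a -> v \in sub_part b ->
  sub_br u v \in sub_part (a (+) b).
Proof. by rewrite !mem_sub_part val_sub_br; apply: lsa_graded. Qed.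

Lemma sub_anti a b u v : u \in sub_part a -> v \in sub_part b ->
  sub_br u v = - ((-1) ^+ (a && b) *: sub_br v u).
Proof.
rewrite !mem_sub_part => ua vb; apply: val_inj => /=.
by rewrite !val_sub_br; apply: lsa_anti.
Qed.

Lemma sub_jacobi a b c u v w :
  u \in sub_part a -> v \in sub_part b -> w \in sub_part c ->
  sub_br u (sub_br v w)
    = sub_br (sub_br u v) w + (-1) ^+ (a && b) *: sub_br v (sub_br u w).
Proof.
rewrite !mem_sub_part => ua vb wc; apply: val_inj => /=.
rewrite !val_sub_br; exact: lsa_jacobi ua vb wc.
Qed.

Definition subLieSuperalgebra : lieSuperalgebra K :=
  @LieSuperalgebra K (subvs_of U) sub_part sub_br
    sub_direct sub_full sub_graded sub_anti sub_jacobi.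

End SubLieSuperalgebra.

Section Supermatrices.
Variables (K : fieldType) (m n : nat).
Implicit Types (A B C : 'M[K]_(m + n)) (x y : 'cV[K]_(m + n)).

(* The first m coordinates of K^{m|n} are even, the last n ones are odd. *)
Definition idx_par (i : 'I_(m + n)) : bool := (m <= i)%N.

Definition mxpart (a : bool) A : 'M[K]_(m + n) :=
  \matrix_(i, j) (A i j *+ (idx_par i (+) idx_par j == a)).

Definition cvpar (a : bool) x : Prop := forall i, idx_par i != a -> x i 0 = 0.

Lemma mxpart_linear a : linear (mxpart a).
Proof.
by move=> k A B; apply/matrixP=> i j; rewrite !mxE mulrnDl mulrnAr.
Qed.

HB.instance Definition _ a :=
  GRing.isLinear.Build K _ _ _ (mxpart a) (mxpart_linear a).

Lemma mxpart_id a b A : mxpart a (mxpart b A) = if a == b then mxpart b A else 0.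
Proof.
apply/matrixP=> i j; rewrite !mxE; case: (a =P b) => [->|neq_ab].
  by rewrite mxE -mulrnA mulnb andbb.
rewrite mxE -mulrnA mulnb; case: eqP => [->|//]; case: eqP => // eq_ba.
by case: neq_ab.
Qed.

Lemma mxpart_sum A : A = mxpart false A + mxpart true A.
Proof.
apply/matrixP=> i j; rewrite !mxE.
by case: (_ (+) _); rewrite /= ?addr0 ?add0r.
Qed.

Lemma mxpart_mul a b A B :
  mxpart (a (+) b) (mxpart a A *m mxpart b B) = mxpart a A *m mxpart b B.
Proof.
apply/matrixP=> i j; rewrite [LHS]mxE; case: eqP => [//|neq].
rewrite mulr0n mxE big1 // => k _; rewrite !mxE.
case: eqP => [ea|_]; last by rewrite mulr0n mul0r.
case: eqP => [eb|_]; last by rewrite mulr0n mulr0.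
by case: neq; rewrite -ea -eb addbA addbK.
Qed.

Definition gl_part (a : bool) : {vspace 'M[K]_(m + n)} :=
  limg (linfun (mxpart a)).

Lemma mem_gl_part a A : (A \in gl_part a) = (mxpart a A == A).
Proof.
apply/memv_imgP/eqP => [[B _ ->]|<-].
  by rewrite lfunE /= mxpart_id eqxx.
by exists A; rewrite ?memvf ?lfunE.
Qed.

Lemma mxpart_gl a A : mxpart a A \in gl_part a.
Proof. by rewrite mem_gl_part mxpart_id eqxx. Qed.

Lemma gl_part_homog a b A : A \in gl_part a ->
  mxpart b A = if b == a then A else 0.
Proof. by rewrite mem_gl_part => /eqP <-; apply: mxpart_id. Qed.

Lemma gl_part_mul a b A B : A \in gl_part a -> B \in gl_part b ->
  A *m B \in gl_part (a (+) b).
Proof.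
rewrite !mem_gl_part => /eqP Aa /eqP Bb.
by have := mxpart_mul a b A B; rewrite Aa Bb => ->.
Qed.

Definition superbr A B : 'M[K]_(m + n) :=
  \sum_(a : bool) \sum_(b : bool)
    (mxpart a A *m mxpart b B - (-1) ^+ (a && b) *: (mxpart b B *m mxpart a A)).

Lemma superbr_bilinear : bilinear_for *:%R *:%R superbr.
Proof.
split=> A k B C; rewrite /= /superbr; rewrite scaler_sumr -big_split /=;
  apply: eq_bigr => a _; rewrite scaler_sumr -big_split /=; apply: eq_bigr => b _;
  rewrite linearP /= mulmxDl mulmxDr -!scalemxAl -!scalemxAr;
  rewrite scalerBr scalerDr !scalerA [k * _]mulrC opprD -!addrA; congr (_ + _);
  by rewrite addrCA.
Qed.

HB.instance Definition _ :=
  bilinear_isBilinear.Build K 'M[K]_(m + n) 'M[K]_(m + n) 'M[K]_(m + n)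
    *:%R *:%R superbr superbr_bilinear.

Lemma superbrE a b A B : A \in gl_part a -> B \in gl_part b ->
  superbr A B = A *m B - (-1) ^+ (a && b) *: (B *m A).
Proof.
move=> Aa Bb; rewrite /superbr (bigD1 a) //= [X in _ + X]big1 ?addr0.
  rewrite (bigD1 b) //= [X in _ + X]big1 ?addr0.
    by rewrite (gl_part_homog _ Aa) (gl_part_homog _ Bb) !eqxx.
  move=> c /negPf c_b; rewrite (gl_part_homog _ Bb) c_b.
  by rewrite mul0mx mulmx0 scaler0 subr0.
move=> c /negPf c_a; rewrite big1 // => d _; rewrite (gl_part_homog _ Aa) c_a.
by rewrite mul0mx mulmx0 scaler0 subr0.
Qed.

Lemma gl_direct : (gl_part false :&: gl_part true)%VS = 0%VS.
Proof.
apply/eqP; rewrite -subv0; apply/subvP => A.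
rewrite memv_cap memv0 => /andP[A0 A1].
by move: A1; rewrite mem_gl_part (gl_part_homog _ A0) /= eq_sym.
Qed.

Lemma gl_full : (gl_part false + gl_part true)%VS = fullv.
Proof.
apply/eqP; rewrite eqEsubv subvf /=; apply/subvP => A _.
by rewrite [A]mxpart_sum memv_add ?mxpart_gl.
Qed.

Lemma gl_graded a b A B : A \in gl_part a -> B \in gl_part b ->
  superbr A B \in gl_part (a (+) b).
Proof.
move=> Aa Bb; rewrite (superbrE Aa Bb) rpredB ?gl_part_mul //.
by rewrite rpredZ // addbC gl_part_mul.
Qed.

Lemma gl_anti a b A B : A \in gl_part a -> B \in gl_part b ->
  superbr A B = - ((-1) ^+ (a && b) *: superbr B A).
Proof.
move=> Aa Bb; rewrite (superbrE Aa Bb) (superbrE Bb Aa) [b && a]andbC.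
rewrite scalerBr scalerA -expr2 sqrr_sign scale1r opprB.
by [].
Qed.

Lemma gl_jacobi a b c A B C :
  A \in gl_part a -> B \in gl_part b -> C \in gl_part c ->
  superbr A (superbr B C)
    = superbr (superbr A B) C + (-1) ^+ (a && b) *: superbr B (superbr A C).
Proof.
move=> Aa Bb Cc.
rewrite (superbrE Aa (gl_graded Bb Cc)) (superbrE (gl_graded Aa Bb) Cc).
rewrite (superbrE Bb (gl_graded Aa Cc)).
rewrite (superbrE Bb Cc) (superbrE Aa Bb) (superbrE Aa Cc).
rewrite !mulmxBl !mulmxBr -!scalemxAl -!scalemxAr !mulmxA.
move: (A *m B *m C) (A *m C *m B) (B *m A *m C) (B *m C *m A)
  (C *m A *m B) (C *m B *m A) => ABC ACB BAC BCA CAB CBA.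
apply/matrixP => i j; rewrite !mxE.
by case: a b c {Aa Bb Cc} => [] [] [] /=; ring.
Qed.

Definition gl : lieSuperalgebra K :=
  @LieSuperalgebra K 'M[K]_(m + n) gl_part superbr
    gl_direct gl_full gl_graded gl_anti gl_jacobi.

Lemma gl_sub_graded (U : {vspace gl}) :
  (forall a A, A \in U -> mxpart a A \in U) ->
  (U <= U :&: lsa_part gl false + U :&: lsa_part gl true)%VS.
Proof.
move=> Upart; apply/subvP => A AU; rewrite [A]mxpart_sum.
by apply: memv_add; rewrite memv_cap Upart ?mxpart_gl.
Qed.

Lemma superbr_sum A B :
  superbr A B = \sum_(a : bool) \sum_(b : bool) superbr (mxpart a A) (mxpart b B).
Proof.
by apply: eq_bigr => a _; apply: eq_bigr => b _;
  rewrite (superbrE (mxpart_gl a A) (mxpart_gl b B)).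
Qed.

Definition supertrace A : K^o := \sum_i (-1) ^+ idx_par i * A i i.

Lemma supertrace_linear : linear supertrace.
Proof.
move=> k A B; rewrite /supertrace scaler_sumr -big_split; apply: eq_bigr => i _.
by rewrite !mxE mulrDr /GRing.scale /= mulrCA.
Qed.

HB.instance Definition _ :=
  GRing.isLinear.Build K _ _ _ supertrace supertrace_linear.

Definition sl_vs : {vspace gl} := lker (linfun supertrace).

Lemma mem_sl A : (A \in sl_vs) = (supertrace A == 0).
Proof. by rewrite memv_ker lfunE. Qed.

Lemma supertrace_odd A : supertrace (mxpart true A) = 0.
Proof. by rewrite /supertrace big1 // => i _; rewrite !mxE addbb mulr0. Qed.

Lemma supertrace_even A : supertrace (mxpart false A) = supertrace A.
Proof. by apply: eq_bigr => i _; rewrite !mxE addbb. Qed.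

Lemma supertrace_br A B : supertrace (superbr A B) = 0.
Proof.
rewrite /superbr linear_sum big1 //= => a _; rewrite linear_sum big1 //= => b _.
rewrite linearB linearZ /=; apply/eqP; rewrite subr_eq0; apply/eqP.
rewrite /supertrace.
under eq_bigr => i _ do rewrite mxE mulr_sumr.
rewrite exchange_big /= scaler_sumr; apply: eq_bigr => j _.
rewrite mxE mulr_sumr scaler_sumr; apply: eq_bigr => i _.
rewrite !mxE /GRing.scale /=.
case: (idx_par i) (idx_par j) a b => [] [] [] [] /=;
  rewrite ?mulr0n ?mulr1n; ring.
Qed.

Lemma sl_graded :
  (sl_vs <= sl_vs :&: lsa_part gl false + sl_vs :&: lsa_part gl true)%VS.
Proof.
apply: gl_sub_graded => -[] A; rewrite !mem_sl ?supertrace_odd //.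
by rewrite supertrace_even.
Qed.

Lemma sl_br A B : A \in sl_vs -> B \in sl_vs -> lsa_br gl A B \in sl_vs.
Proof. by move=> _ _; rewrite mem_sl; apply/eqP/supertrace_br. Qed.

Definition sl : lieSuperalgebra K := subLieSuperalgebra sl_graded sl_br.

(* The bilinear form on K^{m|n} with Gram matrix [S]. *)
Definition gram_form (S : 'M[K]_(m + n)) x y : K := (x^T *m S *m y) 0 0.

Definition super_form (S : 'M[K]_(m + n)) : Prop :=
  [/\ (forall a b x y, cvpar a x -> cvpar b y -> a != b ->
         gram_form S x y = 0),
      (forall a b x y, cvpar a x -> cvpar b y ->
         gram_form S x y = (-1) ^+ (a && b) * gram_form S y x)
    & (forall x, (forall y, gram_form S x y = 0) -> x = 0)].

Definition preserves_form (S : 'M[K]_(m + n)) (a : bool) A : Prop :=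
  forall b x y, cvpar b x ->
    gram_form S (A *m x) y + (-1) ^+ (a && b) * gram_form S x (A *m y) = 0.

Definition sgn_mx (a : bool) : 'M[K]_(m + n) :=
  diag_mx (\row_i (-1) ^+ (a && idx_par i)).

(* osp(S) must be a {vspace _}, so it is cut out by linear equations on the   *)
(* matrix entries; [mem_ospP] shows that it consists of the supermatrices     *)
(* whose homogeneous components preserve the form.                            *)
Definition form_defect (S : 'M[K]_(m + n)) (a : bool) A : 'M[K]_(m + n) :=
  (mxpart a A)^T *m S + sgn_mx a *m S *m mxpart a A.

Lemma form_defect_linear S a : linear (form_defect S a).
Proof.
move=> k A B; rewrite /form_defect linearP /= linearP /= mulmxDl mulmxDr.
by rewrite -scalemxAl -scalemxAr scalerDr addrACA.
Qed.

HB.instance Definition _ S a :=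
  GRing.isLinear.Build K _ _ _ (form_defect S a) (form_defect_linear S a).

Definition osp_vs (S : 'M[K]_(m + n)) : {vspace gl} :=
  (\bigcap_(a : bool) lker (linfun (form_defect S a)))%VS.

Lemma sgn_mx_par a b x : cvpar b x -> x^T *m sgn_mx a = (-1) ^+ (a && b) *: x^T.
Proof.
move=> xb; apply/matrixP => i j; rewrite mul_mx_diag !mxE (ord1 i) mulrC.
have [->//|/xb ->] := eqVneq (idx_par j) b.
by rewrite !mulr0.
Qed.

Lemma preserves_formP S a A :
  form_defect S a A = 0 <-> preserves_form S a (mxpart a A).
Proof.
rewrite /form_defect /preserves_form /gram_form; set X := mxpart a A.
have key b x y : cvpar b x ->
    ((X *m x)^T *m S *m y) 0 0 + (-1) ^+ (a && b) * (x^T *m S *m (X *m y)) 0 0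
    = (x^T *m (X^T *m S + sgn_mx a *m S *m X) *m y) 0 0.
  move=> xb; rewrite mulmxDr mulmxDl [in RHS]mxE trmx_mul !mulmxA (sgn_mx_par _ xb).
  by congr (_ + _); rewrite -!scalemxAl [RHS]mxE.
split=> [E b x y xb|E]; first by rewrite (key b) // E mulmx0 mul0mx mxE.
apply/matrixP => i j.
have e_par : cvpar (idx_par i) (delta_mx i 0).
  by move=> k; rewrite mxE andbT; have [->|//] := eqVneq k i; rewrite eqxx.
have := E _ _ (delta_mx j 0) e_par; rewrite (key _ _ _ e_par).
by rewrite trmx_delta -rowE -colE !mxE.
Qed.

Lemma mem_ospE S A :
  (A \in osp_vs S) = [forall a, form_defect S a A == 0].
Proof.
rewrite memvE; apply/subv_bigcapP/forallP => H a.
  by have := H a isT; rewrite -memvE memv_ker lfunE.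
move=> _; rewrite -memvE memv_ker lfunE; exact: H.
Qed.

Lemma mem_ospP S A :
  A \in osp_vs S <-> forall a, preserves_form S a (mxpart a A).
Proof.
rewrite mem_ospE; split=> [/forallP H a|H].
  by apply/preserves_formP/eqP/H.
by apply/forallP => a; apply/eqP/preserves_formP.
Qed.

Lemma osp_part S a A : A \in osp_vs S -> mxpart a A \in osp_vs S.
Proof.
rewrite !mem_ospE => /forallP H; apply/forallP => b; move: (H b).
rewrite /form_defect mxpart_id; have [<-//|_ _] := eqVneq b a.
by rewrite trmx0 mul0mx mulmx0 addr0.
Qed.

Lemma cvpar_mul a b A x : A \in gl_part a -> cvpar b x ->
  cvpar (a (+) b) (A *m x).
Proof.
rewrite mem_gl_part => /eqP <- xb i i_ab; rewrite mxE big1 // => j _.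
have [jb|/xb ->] := eqVneq (idx_par j) b; last by rewrite mulr0.
rewrite mxE; case: eqP => [ia|_]; last by rewrite mul0r.
by move: i_ab; rewrite -ia -jb addbK eqxx.
Qed.

Lemma preserves_br S a b A B :
  A \in gl_part a -> B \in gl_part b ->
  preserves_form S a A -> preserves_form S b B ->
  preserves_form S (a (+) b) (superbr A B).
Proof.
move=> Aa Bb SA SB c x y xc; rewrite (superbrE Aa Bb).
have formD u v w : gram_form S (u + v) w = gram_form S u w + gram_form S v w.
  by rewrite /gram_form linearD /= !mulmxDl mxE.
have formDr u v w : gram_form S u (v + w) = gram_form S u v + gram_form S u w.
  by rewrite /gram_form !mulmxDr mxE.
have formZ k u v : gram_form S (k *: u) v = k * gram_form S u v.
  by rewrite /gram_form linearZ /= -!scalemxAl mxE.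
have formZr k u v : gram_form S u (k *: v) = k * gram_form S u v.
  by rewrite /gram_form -scalemxAr mxE.
rewrite !mulmxBl -!scalemxAl -!mulmxA -!scaleNr !(formD, formDr, formZ, formZr).
have {formD formDr formZ formZr} tr d e C u v : preserves_form S d C ->
    cvpar e u ->
    gram_form S (C *m u) v = - ((-1) ^+ (d && e) * gram_form S u (C *m v)).
  by move=> SC ue; apply/eqP; rewrite -addr_eq0; apply/eqP; apply: SC.
rewrite (tr _ _ _ _ _ SA (cvpar_mul Bb xc)) (tr _ _ _ _ _ SB xc).
rewrite (tr _ _ _ _ _ SB (cvpar_mul Aa xc)) (tr _ _ _ _ _ SA xc).
by case: a b c {tr SA SB Aa Bb xc} => [] [] [] /=; ring.
Qed.

Lemma osp_br S A B :
  A \in osp_vs S -> B \in osp_vs S -> lsa_br gl A B \in osp_vs S.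
Proof.
move=> /mem_ospP SA /mem_ospP SB; rewrite [lsa_br gl A B]superbr_sum.
apply: rpred_sum => a _; apply: rpred_sum => b _; apply/mem_ospP => c.
rewrite (gl_part_homog _ (gl_graded (mxpart_gl a A) (mxpart_gl b B))).
case: eqP => [->|_].
  exact: preserves_br (mxpart_gl a A) (mxpart_gl b B) (SA a) (SB b).
by move=> d x y _; rewrite /gram_form !mul0mx trmx0 mulmx0 !mul0mx !mxE mulr0 addr0.
Qed.

Lemma osp_graded S :
  (osp_vs S <= osp_vs S :&: lsa_part gl false + osp_vs S :&: lsa_part gl true)%VS.
Proof. by apply: gl_sub_graded => a A; apply: osp_part. Qed.

Definition osp (S : 'M[K]_(m + n)) : lieSuperalgebra K :=
  subLieSuperalgebra (@osp_graded S) (@osp_br S).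

End Supermatrices.

(* Main.v *)
From HB Require Import structures.
Require Import Defs.
From mathcomp Require Import all_boot all_order all_algebra.
From mathcomp Require Import ring zify.

Set Implicit Arguments.
Unset Strict Implicit.
Unset Printing Implicit Defensive.

Import GRing.Theory.
Local Open Scope ring_scope.

(* Each of the three algebras has a torus T with pairwise distinct one-       *)
(* dimensional root spaces. Since p > 3 the root coordinates stay distinct    *)
(* modulo p, and as K is infinite a single h in T separates all roots: its    *)
(* coordinates are combinations of 1 and t, where t^p = t + 1 keeps t out of  *)
(* the prime field. Modulo inner derivations a derivation D has D h in T;     *)
(* comparing ad h-eigenspaces, D kills T and scales each root vector. If D is *)
(* odd it vanishes for parity reasons, and if D is even additivity of the     *)
(* scalars along brackets of root vectors makes D the adjoint action of an    *)
(* element of T. For osp the root vectors joining the unique self-paired      *)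
(* index to the other ones suffice, as they generate.                         *)
(* The supertrace form is invariant and nondegenerate, so a 2-cocycle is      *)
(* (x, y) |-> B(D x, y) for a derivation D = ad u, that is B(u, [x, y]).      *)
(* Finally, an arbitrary supersymmetric form is brought to a monomial one by  *)
(* hyperbolic pairs, and conjugation transports the result.                   *)

(** * Lie superalgebras: projections, inner derivations, invariant forms *)

(** The proof separates an abstract statement from its verification. [H1_adjoint_eq0_toral] asks of
    an even element h that ad h be diagonalizable, that its centralizer be an even abelian torus,
    and that each root space be a line. Subtracting an inner derivation moves D h into the torus,
    and the Leibniz rule against h then makes D diagonal on root vectors. What remains is to show
    that an even D scales the root vector of (i, j) by some g_i - g_j with diag g in the algebra.
    [H1_sl] reads this off [E_ij, E_jk] = E_ik and corrects g by a scalar matrix. [H1_osp_monomial]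
    brackets through the self-paired index o, using [superbr_root_o]. [H2_trivial_of_H1] turns a
    cocycle into a derivation by means of an invariant nondegenerate form. For the supertrace form,
    nondegeneracy rests on m != n in K for sl(m|n) and on 2 != 0 for osp. The bound p > 3 enters
    through [generic_combination_eq0]: the root coordinates to be compared differ by integers of
    absolute value at most 4. A general form S is handled by [osp_cohomology_of_basis], which needs
    only a basis of hyperbolic pairs plus one anisotropic even vector. *)

Section LieSuperalgebras.
Variables (K : fieldType) (L : lieSuperalgebra K).
Implicit Types (a b d : bool) (x y z u h : L).

Definition lsa_pr a : 'End(L) := daddv_pi (lsa_part L a) (lsa_part L (~~ a)).

Lemma memv_lsa_pr a x : lsa_pr a x \in lsa_part L a.
Proof. exact: memv_pi. Qed.

Lemma lsa_pr_sum x : x = lsa_pr false x + lsa_pr true x.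
Proof. by rewrite daddv_pi_add ?lsa_direct // lsa_full memvf. Qed.

Lemma lsa_part_cap a x : x \in lsa_part L a -> x \in lsa_part L (~~ a) -> x = 0.
Proof.
move=> xa xna; apply/eqP; rewrite -memv0 -(lsa_direct L) memv_cap.
by case: a xa xna => /= -> ->.
Qed.

Lemma lsa_part_neq a b x :
  x \in lsa_part L a -> x \in lsa_part L b -> a != b -> x = 0.
Proof. by move=> xa xb ab; apply: (@lsa_part_cap a); case: a b xa xb ab => [] []. Qed.

Lemma lsa_pr_homog a b x : x \in lsa_part L b ->
  lsa_pr a x = if a == b then x else 0.
Proof.
move=> xb.
have aux c : x \in lsa_part L (~~ c) -> lsa_pr c x = 0.
  move=> xnc; apply: (@lsa_part_cap c); first exact: memv_lsa_pr.
  have -> : lsa_pr c x = x - lsa_pr (~~ c) x.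
    by rewrite {2}(lsa_pr_sum x); case: (c); rewrite /= ?addrK // addrC addKr.
  by rewrite rpredB ?memv_lsa_pr.
case: eqP => [->|/eqP ab]; last by apply: aux; case: a b xb ab => [] [].
apply/eqP; rewrite eq_sym {1}(lsa_pr_sum x); apply/eqP.
by have := aux (~~ b); rewrite negbK => /(_ xb); case: (b) => /= ->;
  rewrite ?addr0 ?add0r.
Qed.

Lemma lsa_br_ext u (D : {linear L -> L}) x :
  (forall b y, y \in lsa_part L b -> D y = lsa_br L u y) -> D x = lsa_br L u x.
Proof.
by move=> E; rewrite (lsa_pr_sum x) !linearD; congr (_ + _); apply: E; apply: memv_lsa_pr.
Qed.

Lemma lsa_pr_brl a b x y : y \in lsa_part L b ->
  lsa_pr a (lsa_br L x y) = lsa_br L (lsa_pr (a (+) b) x) y.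
Proof.
move=> yb; rewrite [x in LHS]lsa_pr_sum linearDl linearD /=.
rewrite (lsa_pr_homog _ (lsa_graded (memv_lsa_pr false x) yb)).
rewrite (lsa_pr_homog _ (lsa_graded (memv_lsa_pr true x) yb)).
by case: a b {yb} => [] [] /=; rewrite ?addr0 ?add0r.
Qed.

Lemma lsa_anti_even h x : h \in lsa_part L false -> lsa_br L h x = - lsa_br L x h.
Proof.
move=> h0; rewrite (lsa_pr_sum x) linearD linearDl /= opprD.
by congr (_ + _); rewrite (lsa_anti h0 (memv_lsa_pr _ _)) scale1r.
Qed.

Lemma lsa_jacobi_evenr a x y z : x \in lsa_part L a -> y \in lsa_part L false ->
  lsa_br L x (lsa_br L y z) = lsa_br L (lsa_br L x y) z + lsa_br L y (lsa_br L x z).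
Proof.
move=> xa y0; rewrite (lsa_pr_sum z) !linearD /=.
by rewrite !(lsa_jacobi xa y0 (memv_lsa_pr _ _)) andbF !scale1r addrACA.
Qed.

Lemma ad_superderivation d u : u \in lsa_part L d ->
  superderivation d (linfun (lsa_br L u)).
Proof.
move=> ud; split=> [a x xa|a x y xa]; first by rewrite /= lfunE lsa_graded.
rewrite /= !lfunE /= (lsa_pr_sum y) !linearD /=.
by rewrite !(lsa_jacobi ud xa (memv_lsa_pr _ _)) addrACA.
Qed.

Lemma even_superderivation_br (D : {linear L -> L}) x y : superderivation false D ->
  D (lsa_br L x y) = lsa_br L (D x) y + lsa_br L x (D y).
Proof.
case=> _ Dd; rewrite (lsa_pr_sum x) linearDl !linearD /= linearDl.
by rewrite !(Dd _ _ _ (memv_lsa_pr _ _)) !scale1r linearDl /= addrACA.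
Qed.

Lemma superderivationB d (D E : 'End(L)) :
  superderivation d D -> superderivation d E -> superderivation d (D - E).
Proof.
move=> [Dp Dd] [Ep Ed]; split=> [a x xa|a x y xa]; rewrite /= !(add_lfunE, opp_lfunE).
  by rewrite rpredB ?Dp ?Ep.
rewrite (Dd _ _ _ xa) (Ed _ _ _ xa) linearBl linearB /= scalerBr opprD.
by rewrite addrACA.
Qed.

(** * From first to second cohomology through an invariant form *)

Section InvariantForm.
Variable B : {biscalar L}.
Hypothesis B_inv : forall x y z, B (lsa_br L x y) z = B x (lsa_br L y z).
Hypothesis B_nondeg : forall x, (forall y, B x y = 0) -> x = 0.

Let toHom (w : {biscalar L}) u : 'Hom(L, K^o) := linfun (w u : L -> K^o).

Fact toHom_linear w : linear (toHom w).
Proof.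
by move=> k u v; apply/lfunP => x; rewrite add_lfunE scale_lfunE !lfunE /= linearPl.
Qed.
HB.instance Definition _ w := GRing.isLinear.Build K _ _ _ (toHom w) (toHom_linear w).

(** Nondegeneracy makes x |-> B(x, .) injective into the dual space, hence bijective by dimension; D
    is its inverse composed with x |-> w(x, .). *)
Lemma biscalar_represented (w : {biscalar L}) :
  exists D : {linear L -> L}, forall x y, w x y = B (D x) y.
Proof.
have ker0 : lker (linfun (toHom B)) == 0%VS.
  rewrite -subv0; apply/subvP => u; rewrite memv_ker lfunE /= memv0 => /eqP u0.
  apply/eqP/B_nondeg => y.
  by have := congr1 (fun f : 'Hom(L, K^o) => f y) u0; rewrite /toHom lfunE zero_lfunE.
have onto : limg (linfun (toHom B)) = fullv.
  apply/eqP; rewrite eqEdim subvf /= limg_dim_eq; last first.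
    by apply/eqP; rewrite (eqP ker0) capv0.
  by rewrite !dimvf; apply: eq_leq; exact: muln1.
exists ((linfun (toHom B))^-1 \o linfun (toHom w))%VF => x y.
rewrite /= comp_lfunE; set f := linfun (toHom w) x.
have /limg_lfunVK E : f \in limg (linfun (toHom B)) by rewrite onto memvf.
have := congr1 (fun f : 'Hom(L, K^o) => f y) E.
by rewrite /f (lfunE (toHom B)) (lfunE (toHom w)) /= /toHom !lfunE.
Qed.

(** Writing w(x, y) = B(D x, y), invariance turns the cocycle identity into a Leibniz rule for D. If
    D = ad u, then w(x, y) = B(u, [x, y]) is a coboundary. *)
Lemma H2_trivial_of_H1 : H1_adjoint_eq0 L -> H2_trivial_eq0 L.
Proof.
move=> H1 w [_ wJ]; have [D wD] := biscalar_represented w.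
have Dbr a b x y : x \in lsa_part L a -> y \in lsa_part L b ->
    D (lsa_br L x y) = lsa_br L (D x) y - (-1) ^+ (a && b) *: lsa_br L (D y) x.
  move=> xa yb; apply/eqP; rewrite -subr_eq0; apply/eqP/B_nondeg => z.
  rewrite linearBl linearBl linearZl_LR /= !B_inv -!wD (wJ _ _ _ _ _ xa yb).
  by rewrite subrr.
(* D may mix parities, while [H1] speaks of homogeneous derivations: [Dd d] is the component of D of
   parity d. *)
pose Dd d : 'End(L) := (\sum_(a : bool)
  (lsa_pr (d (+) a) \o linfun D \o lsa_pr a))%VF.
have DdE d a x : x \in lsa_part L a -> Dd d x = lsa_pr (d (+) a) (D x).
  move=> xa; rewrite /Dd sum_lfunE (bigD1 a) //= big1 ?addr0.
    by rewrite !comp_lfunE lfunE /= (lsa_pr_homog _ xa) eqxx.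
  move=> b ba; rewrite !comp_lfunE /= (lsa_pr_homog _ xa) (negPf ba).
  by rewrite !linear0.
have Dinn d : exists2 u, u \in lsa_part L d & forall x, Dd d x = lsa_br L u x.
  apply: H1; split=> [a x xa|a x y xa]; first by rewrite /= (DdE _ _ _ xa) memv_lsa_pr.
  have homog b z : z \in lsa_part L b -> Dd d (lsa_br L x z) =
      lsa_br L (Dd d x) z + (-1) ^+ (d && a) *: lsa_br L x (Dd d z).
    move=> zb; rewrite (DdE _ _ _ (lsa_graded xa zb)) (Dbr _ _ _ _ xa zb).
    rewrite (DdE _ _ _ xa) (DdE _ _ _ zb).
    rewrite linearB linearZ /= (lsa_pr_brl _ _ xa) (lsa_pr_brl _ _ zb).
    have -> : d (+) (a (+) b) (+) b = d (+) a by rewrite addbA addbK.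
    have -> : d (+) (a (+) b) (+) a = d (+) b by rewrite (addbC a) addbA addbK.
    (* Swapping x with an element of parity d + b turns the sign (-1)^(ab) into (-1)^(ab + (d+b)a) =
       (-1)^(da). *)
    congr (_ + _); rewrite (lsa_anti (memv_lsa_pr (d (+) b) (D z)) xa).
    rewrite -scalerN opprK scalerA -signr_addb; congr ((-1) ^+ _ *: _).
    by case: (a) (b) (d) => [] [] [].
  rewrite (lsa_pr_sum y) !linearD /= !(homog _ _ (memv_lsa_pr _ _)).
  by rewrite addrACA.
have [u0 _ Du0] := Dinn false; have [u1 _ Du1] := Dinn true.
have DE x : D x = lsa_br L (u0 + u1) x.
  apply: lsa_br_ext => b z zb.
  rewrite linearDl -Du0 -Du1 !(DdE _ _ _ zb) [LHS]lsa_pr_sum.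
  by case: (b) => //=; rewrite addrC.
exists (B (u0 + u1)) => x y.
by rewrite wD DE B_inv.
Qed.
End InvariantForm.

(** * Derivations in the presence of a separating toral element *)

Section Toral.
(** The torus is the centralizer of h and is expressed throughout by [h, t] = 0. The family e may
    list proportional root vectors under different indices. *)
Variables (I : Type) (h : L) (e : I -> L) (par : I -> bool) (lam : I -> K).
Hypothesis h_even : h \in lsa_part L false.
Hypothesis e_par : forall i, e i \in lsa_part L (par i).
Hypothesis br_he : forall i, lsa_br L h (e i) = lam i *: e i.
(* Diagonalizability of ad h: (ad h - c)^2 x = 0 implies (ad h - c) x = 0,
   with y standing for (ad h - c) x. *)
Hypothesis h_semisimple : forall c x y,
  lsa_br L h x = c *: x + y -> lsa_br L h y = c *: y -> y = 0.
Hypothesis torus_even : forall t, lsa_br L h t = 0 -> t \in lsa_part L false.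
Hypothesis torus_abelian : forall s t,
  lsa_br L h s = 0 -> lsa_br L h t = 0 -> lsa_br L s t = 0.
Hypothesis root_line : forall i x, lsa_br L h x = lam i *: x ->
  exists c, x = c *: e i.
Hypothesis torus_faithful : forall t, lsa_br L h t = 0 ->
  (forall i, lsa_br L t (e i) = 0) -> t = 0.
Hypothesis torus_root_span : forall D : {linear L -> L},
  (forall t, lsa_br L h t = 0 -> D t = 0) -> (forall i, D (e i) = 0) ->
  forall x, D x = 0.
Hypothesis diagonal_inner : forall D : {linear L -> L},
  superderivation false D -> (forall t, lsa_br L h t = 0 -> D t = 0) ->
  (forall i, exists c, D (e i) = c *: e i) ->
  exists2 t, lsa_br L h t = 0 & forall i, D (e i) = lsa_br L t (e i).

(** Semisimplicity at the eigenvalue 0 makes the kernel and the image of ad h meet trivially, so by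
    dimension they span L. *)
Lemma toral_decomposition x : exists t v, lsa_br L h t = 0 /\ x = t + lsa_br L v h.
Proof.
pose A : 'End(L) := linfun (lsa_br L h).
have dir : (lker A :&: limg A = 0)%VS.
  apply/eqP; rewrite -subv0; apply/subvP => y; rewrite memv_cap memv_ker memv0.
  case/andP=> /eqP Ay /memv_imgP[v _ yE]; apply/eqP/(h_semisimple (c := 0) (x := v)).
    by rewrite scale0r add0r yE lfunE.
  by rewrite scale0r -[RHS]Ay lfunE.
have full : (lker A + limg A = fullv)%VS.
  apply/eqP; rewrite eqEdim subvf /= dimv_disjoint_sum // -(limg_ker_dim A fullv).
  by rewrite capfv.
have /memv_addP[t + [y + ->]] : x \in (lker A + limg A)%VS by rewrite full memvf.
rewrite memv_ker => /eqP At /memv_imgP[v _ ->]; exists t, (- v).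
by rewrite -At !lfunE /= linearNl -lsa_anti_even.
Qed.

Lemma H1_adjoint_eq0_toral : H1_adjoint_eq0 L.
Proof.
move=> d D sD.
have [t0 [v [ht0 Dh]]] := toral_decomposition (D h).
(* Projection to parity d commutes with bracketing by the even h, so u can be the component of v
   with the parity of D. *)
have [u ud torusDh] : exists2 u, u \in lsa_part L d &
    lsa_br L h (D h - lsa_br L u h) = 0.
  exists (lsa_pr d v); first exact: memv_lsa_pr.
  have Dhd : D h \in lsa_part L d by have := sD.1 _ _ h_even; rewrite addbF.
  have -> : D h = lsa_pr d t0 + lsa_br L (lsa_pr d v) h.
    have := lsa_pr_homog d Dhd; rewrite eqxx => <-.
    by rewrite Dh linearD /= (lsa_pr_brl _ _ h_even) addbF.
  rewrite addrK.
  rewrite lsa_anti_even // -{1}[d]addbF -lsa_pr_brl // -[lsa_br _ _ _]opprK.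
  by rewrite -lsa_anti_even // ht0 oppr0 linear0 oppr0.
pose D1 : 'End(L) := linfun D - linfun (lsa_br L u).
have D1E x : D1 x = D x - lsa_br L u x by rewrite /D1 add_lfunE opp_lfunE !lfunE.
have sD1 : superderivation d D1.
  apply: superderivationB (ad_superderivation ud).
  by case: sD => Dp Dd; split=> [a x xa|a x y xa]; rewrite /= !lfunE; eauto.
rewrite -D1E in torusDh.
have D1h x : D1 (lsa_br L h x) = lsa_br L (D1 h) x + lsa_br L h (D1 x).
  by have /= -> := sD1.2 _ _ x h_even; rewrite andbF scale1r.
have torus_root t i : lsa_br L h t = 0 ->
    lsa_br L h (lsa_br L t (e i)) = lam i *: lsa_br L t (e i).
  move=> ht; rewrite (lsa_jacobi_evenr _ h_even (torus_even ht)) ht linear0l add0r.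
  by rewrite br_he linearZ.
have D1t t : lsa_br L h t = 0 -> lsa_br L h (D1 t) = 0.
  move=> ht; have := D1h t; rewrite ht (torus_abelian torusDh ht) linear0 add0r.
  by [].
(* Leibniz gives [h, D1 e] = lam D1 e - [D1 h, e], where [D1 h, e] is itself a lam-eigenvector.
   Semisimplicity makes it vanish, so D1 e lies on the root line. *)
have D1e i : exists c, D1 (e i) = c *: e i.
  apply: root_line; have := D1h (e i); rewrite br_he linearZ /= => E.
  have y0 : - lsa_br L (D1 h) (e i) = 0.
    apply: (h_semisimple (c := lam i) (x := D1 (e i))).
      by rewrite E addrC addKr.
    by rewrite linearN /= (torus_root _ _ torusDh) scalerN.
  by rewrite E -[lsa_br L (D1 h) _]opprK y0 oppr0 add0r.
suff [t td D1x] : exists2 t, t \in lsa_part L d & forall x, D1 x = lsa_br L t x.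
  exists (u + t); first by rewrite rpredD.
  by move=> x; rewrite linearDl -D1x D1E addrC subrK.
(* An odd D1 preserves the even torus and every homogeneous root line, so it vanishes on both by
   parity. *)
case: d => [|] in ud sD sD1 *.
  exists 0; first exact: mem0v.
  move=> x; rewrite linear0l; apply: (torus_root_span (D := D1)) => [t ht|i].
    apply: (@lsa_part_neq true false); rewrite ?torus_even ?D1t //.
    by have := sD1.1 _ _ (torus_even ht).
  have [c Dc] := D1e i; apply: (@lsa_part_neq (true (+) par i) (par i)).
  - exact: sD1.1 (e_par i).
  - by rewrite /= Dc rpredZ.
  - by case: (par i).
(* Both D1 and ad t are scalars on e i; the Leibniz rule on [t, e i] leaves [D1 t, e i] = 0, and the
   torus acts faithfully. *)
have D1t0 t : lsa_br L h t = 0 -> D1 t = 0.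
  move=> ht; apply: torus_faithful => [|i]; first exact: D1t.
  have [c Dc] := D1e i; have [al tal] := root_line (torus_root _ i ht).
  have /= := sD1.2 _ _ (e i) (torus_even ht).
  rewrite tal linearZ /= Dc scale1r [lsa_br L t (_ *: _)]linearZ /= tal !scalerA mulrC.
  by rewrite -[LHS]add0r => /addIr.
have [t ht Dt] := diagonal_inner sD1 D1t0 D1e.
exists t; first exact: torus_even.
move=> x; apply/eqP; rewrite -subr_eq0; apply/eqP.
pose D2 : 'End(L) := (D1 - linfun (lsa_br L t))%VF.
have D2E y : D2 y = D1 y - lsa_br L t y.
  by rewrite add_lfunE opp_lfunE (lfunE (lsa_br L t)).
rewrite -D2E; apply: (torus_root_span (D := D2)) => [s hs|i].
  by rewrite /= D2E D1t0 // torus_abelian // subrr.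
by rewrite /= D2E Dt subrr.
Qed.
End Toral.

End LieSuperalgebras.

(** * Transport along isomorphisms *)

Section Transfer.
Variables (K : fieldType) (L M : lieSuperalgebra K).
Variables (f : {linear L -> M}) (g : {linear M -> L}).
Hypotheses (fK : cancel f g) (gK : cancel g f).
Hypothesis f_part : forall a x, x \in lsa_part L a -> f x \in lsa_part M a.
Hypothesis f_br : forall x y, f (lsa_br L x y) = lsa_br M (f x) (f y).

(** A bijection preserving parities commutes with the parity projections, so its inverse preserves
    parities too. *)
Let g_part a y : y \in lsa_part M a -> g y \in lsa_part L a.
Proof.
move=> ya; have E : lsa_pr L (~~ a) (g y) = 0.
  apply: (can_inj fK); rewrite linear0.
  have fp b z : f (lsa_pr L b z) = lsa_pr M b (f z).
    rewrite [z in RHS]lsa_pr_sum !linearD /=.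
    by rewrite !(lsa_pr_homog _ (f_part (memv_lsa_pr _ _))); case: b;
       rewrite /= ?addr0 ?add0r.
  by rewrite fp gK (lsa_pr_homog _ ya); case: (a).
have := lsa_pr_sum (g y); case: a ya E => /= _ ->; rewrite ?addr0 ?add0r => ->;
  exact: memv_lsa_pr.
Qed.

Let g_br x y : g (lsa_br M x y) = lsa_br L (g x) (g y).
Proof. by apply: (can_inj fK); rewrite gK f_br !gK. Qed.

Lemma H1_adjoint_eq0_iso : H1_adjoint_eq0 L -> H1_adjoint_eq0 M.
Proof.
move=> H1 d D [Dp Dd]; have [|u ud uE] := H1 d (g \o D \o f).
  split=> [a x xa|a x y xa] /=; first exact/g_part/Dp/f_part.
  by rewrite f_br (Dd _ _ _ (f_part xa)) linearD linearZ /= !g_br !fK.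
exists (f u) => [|x]; first exact: f_part.
by apply: (can_inj gK); rewrite g_br fK -[X in lsa_br L u X]/(g x) -uE /= gK.
Qed.

Definition biscalar_pullback (w : {biscalar M}) x y : K := w (f x) (f y).

Fact biscalar_pullback_bilinear w : bilinear_for *%R *%R (biscalar_pullback w).
Proof.
split=> z k x y; rewrite /biscalar_pullback /=; first by rewrite linearP linearPl.
by rewrite !linearP.
Qed.
HB.instance Definition _ w := bilinear_isBilinear.Build K L L K *%R *%R
  (biscalar_pullback w) (biscalar_pullback_bilinear w).

Lemma H2_trivial_eq0_iso : H2_trivial_eq0 L -> H2_trivial_eq0 M.
Proof.
move=> H2 w [wA wJ]; have [|k kE] := H2 (biscalar_pullback w).
  split=> [a b x y xa yb|a b x y z xa yb] /=; rewrite /biscalar_pullback.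
    exact: wA (f_part xa) (f_part yb).
  by rewrite !f_br (wJ _ _ _ _ _ (f_part xa) (f_part yb)).
exists (k \o g) => x y /=.
by rewrite g_br -kE /= /biscalar_pullback !gK.
Qed.
End Transfer.

(** * Graded subalgebras of gl(m|n) *)

Section GlFacts.
Variables (K : fieldType) (m n : nat).
Implicit Types (A B C : 'M[K]_(m + n)) (v : 'rV[K]_(m + n)) (i j k l : 'I_(m + n)).

Lemma superbrDl A B C : superbr (A + B) C = superbr A C + superbr B C.
Proof. exact: (linearDl (lsa_br (gl K m n))). Qed.

Lemma superbrDr A B C : superbr A (B + C) = superbr A B + superbr A C.
Proof. exact: (linearD (lsa_br (gl K m n) A)). Qed.

Lemma superbrZl c A B : superbr (c *: A) B = c *: superbr A B.
Proof. exact: (linearZl_LR (lsa_br (gl K m n))). Qed.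

Lemma superbrZr c A B : superbr A (c *: B) = c *: superbr A B.
Proof. exact: (linearZr_LR (lsa_br (gl K m n))). Qed.

Lemma diag_mx_even v : diag_mx v \in gl_part K m n false.
Proof.
rewrite mem_gl_part; apply/eqP/matrixP => i j; rewrite !mxE.
by have [->|_] := eqVneq i j; rewrite ?addbb // mul0rn.
Qed.

Lemma delta_mx_par i j : delta_mx i j \in gl_part K m n (idx_par i (+) idx_par j).
Proof.
rewrite mem_gl_part; apply/eqP/matrixP => k l; rewrite !mxE.
by have [->|_] := eqVneq k i; have [->|_] := eqVneq l j;
   rewrite ?eqxx ?mul0rn.
Qed.

Lemma superbr_diag v A :
  superbr (diag_mx v) A = \matrix_(i, j) ((v 0 i - v 0 j) * A i j).
Proof.
rewrite [A in LHS]mxpart_sum superbrDr.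
rewrite !(superbrE (diag_mx_even v) (mxpart_gl _ _)) !scale1r.
rewrite addrACA -opprD -mulmxDr -mulmxDl -mxpart_sum.
apply/matrixP => i j; rewrite mul_diag_mx mul_mx_diag !mxE; ring.
Qed.

Lemma superbr_diag_weight v c A :
  (forall i j, A i j != 0 -> v 0 i - v 0 j = c) ->
  superbr (diag_mx v) A = c *: A.
Proof.
move=> Ac; rewrite superbr_diag; apply/matrixP => i j; rewrite !mxE.
by have [->|/Ac ->//] := eqVneq (A i j) 0; rewrite !mulr0.
Qed.

Lemma supertraceC a b A B : A \in gl_part K m n a -> B \in gl_part K m n b ->
  supertrace (A *m B) = (-1) ^+ (a && b) * supertrace (B *m A).
Proof.
move=> Aa Bb; have := supertrace_br A B; rewrite (superbrE Aa Bb) linearB linearZ /=.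
by move/eqP; rewrite subr_eq0 => /eqP.
Qed.

(** On homogeneous matrices, move B cyclically past AC: the sign (-1)^(b(a+c)) and the (-1)^(ab) of
    the bracket leave (-1)^(bc). Additivity does the rest. *)
Lemma supertrace_invariant A B C :
  supertrace (superbr A B *m C) = supertrace (A *m superbr B C).
Proof.
have hom a b c A' B' C' : A' \in gl_part K m n a -> B' \in gl_part K m n b ->
    C' \in gl_part K m n c ->
    supertrace (superbr A' B' *m C') = supertrace (A' *m superbr B' C').
  move=> Aa Bb Cc; rewrite (superbrE Aa Bb) (superbrE Bb Cc) mulmxBl mulmxBr.
  rewrite -scalemxAl -scalemxAr !linearB !linearZ /= !mulmxA.
  rewrite !scalerN; congr (_ - _).
  rewrite -(mulmxA B' A' C') (supertraceC Bb (gl_part_mul Aa Cc)) /GRing.scale /= mulrA.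
  by rewrite -signr_addb; congr ((-1) ^+ _ * _); case: a b c {Aa Bb Cc} => [] [] [].
have strD X Y : supertrace (X + Y) = supertrace X + supertrace Y :> K by exact: linearD.
rewrite (mxpart_sum C) superbrDr !mulmxDr !strD; congr (_ + _).
all: rewrite (mxpart_sum B) superbrDr superbrDl mulmxDl mulmxDr !strD; congr (_ + _).
all: rewrite (mxpart_sum A) superbrDl !mulmxDl !strD; congr (_ + _).
all: by apply: hom; apply: mxpart_gl.
Qed.

Definition trace_form A B : K := supertrace (A *m B).

Fact trace_form_bilinear : bilinear_for *%R *%R trace_form.
Proof.
by split=> A k B C; rewrite /trace_form /= ?mulmxDl ?mulmxDr
  -?scalemxAl -?scalemxAr linearP.
Qed.
HB.instance Definition _ := bilinear_isBilinear.Build K 'M[K]_(m + n) 'M[K]_(m + n)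
  K *%R *%R trace_form trace_form_bilinear.
End GlFacts.

Section GradedSubalgebra.
Variables (K : fieldType) (m n : nat) (U : {vspace gl K m n}).
Hypothesis U_graded : (U <= U :&: lsa_part (gl K m n) false
                            + U :&: lsa_part (gl K m n) true)%VS.
Hypothesis U_br : forall x y, x \in U -> y \in U -> lsa_br (gl K m n) x y \in U.
Let L := subLieSuperalgebra U_graded U_br.
Local Notation mx := 'M[K]_(m + n).
Implicit Types (A B C : mx) (i j k l : 'I_(m + n)).

Let vbr (x y : L) : vsval (lsa_br L x y) = superbr (vsval x) (vsval y).
Proof. exact: val_sub_br. Qed.

Lemma H2_trivial_sub :
  (forall A, A \in U -> (forall B, B \in U -> supertrace (A *m B) = 0) -> A = 0) ->
  H1_adjoint_eq0 L -> H2_trivial_eq0 L.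
Proof.
move=> nondeg; pose val : {linear L -> gl K m n} := (vsval : subvs_of U -> gl K m n).
apply: (@H2_trivial_of_H1 K L (biscalar_pullback val (@trace_form K m n))).
  move=> x y z; rewrite /= /biscalar_pullback /trace_form /=.
  by rewrite !vbr; apply: supertrace_invariant.
move=> x x0; apply: val_inj; apply: nondeg => [|B BU]; first exact: subvsP.
by have := x0 (vsproj U B); rewrite /= /biscalar_pullback /trace_form /= vsprojK.
Qed.

(** F i j has weight d_i - d_j, and F i i is diagonal. In osp the same root line occurs at two index
    pairs, whence the multiples in [F_line] and the factor r in [F_span]: 1 for sl, 1/2 for osp. *)
Variables (d : 'rV[K]_(m + n)) (F : 'I_(m + n) -> 'I_(m + n) -> mx).
Hypothesis d_inj : injective (d 0).
Hypothesis d_U : diag_mx d \in U.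
Hypothesis F_U : forall i j, i != j -> F i j \in U.
Hypothesis F_par : forall i j, F i j \in gl_part K m n (idx_par i (+) idx_par j).
Hypothesis F_weight : forall i j k l, F i j k l != 0 -> d 0 k - d 0 l = d 0 i - d 0 j.
Hypothesis F_line : forall i j k l, i != j -> d 0 k - d 0 l = d 0 i - d 0 j ->
  exists c, F k l = c *: F i j.
Hypothesis F_span : exists r : K, forall A, A \in U ->
  A = r *: \sum_i \sum_j A i j *: F i j.
Hypothesis F_faithful : forall v, diag_mx v \in U ->
  (forall i j, i != j -> superbr (diag_mx v) (F i j) = 0) -> diag_mx v = 0.
Hypothesis F_inner : forall D : {linear mx -> mx},
  (forall A B, A \in U -> B \in U ->
     D (superbr A B) = superbr (D A) B + superbr A (D B)) ->
  (forall v, diag_mx v \in U -> D (diag_mx v) = 0) ->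
  (forall i j, i != j -> exists c, D (F i j) = c *: F i j) ->
  exists2 v, diag_mx v \in U &
    forall i j, i != j -> D (F i j) = superbr (diag_mx v) (F i j).

Let I := {ij : 'I_(m + n) * 'I_(m + n) | ij.1 != ij.2}.
Let h : L := vsproj U (diag_mx d).
Let e (ij : I) : L := vsproj U (F (\val ij).1 (\val ij).2).

Let val : {linear L -> gl K m n} := (vsval : subvs_of U -> gl K m n).

Let valZ c (x : L) : vsval (c *: x) = c *: vsval x.
Proof. exact: (linearZ_LR val). Qed.

Let valD (x y : L) : vsval (x + y) = vsval x + vsval y.
Proof. exact: (linearD val). Qed.

Let hE : vsval h = diag_mx d. Proof. by rewrite /h vsprojK. Qed.
Let eE i j (ij : i != j) : vsval (e (exist _ (i, j) ij)) = F i j.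
Proof. by rewrite /e vsprojK // F_U. Qed.

Let br_h (x : L) i j : vsval (lsa_br L h x) i j = (d 0 i - d 0 j) * vsval x i j.
Proof. by rewrite vbr hE superbr_diag mxE. Qed.

Let torusP (x : L) : lsa_br L h x = 0 <-> exists v, vsval x = diag_mx v.
Proof.
split=> [hx|[v vE]].
  exists (\row_i vsval x i i); apply/matrixP => i j; rewrite !mxE.
  have [->|ij] := eqVneq i j; first by rewrite mulr1n.
  have := br_h x i j; rewrite hx mxE => /esym/eqP; rewrite mulf_eq0 subr_eq0.
  by rewrite (inj_eq d_inj) (negPf ij) => /eqP ->.
apply: val_inj; apply/matrixP => i j; rewrite br_h vE !mxE.
by have [->|_] := eqVneq i j; rewrite ?subrr ?mul0r ?mulr0n ?mulr0.
Qed.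

Let root_multiple i j (ij : i != j) x c : vsval x = c *: F i j -> x = c *: e (exist _ (i, j) ij).
Proof. by move=> xE; apply: val_inj; rewrite /= eE. Qed.

(** For h = diag d, ad h multiplies the entry (i, j) by d_i - d_j. As the d_i are distinct, the
    centralizer of h is the set of diagonal matrices in U, and the toral hypotheses are checked
    entrywise. *)
Lemma H1_adjoint_eq0_diagonal : H1_adjoint_eq0 L.
Proof.
apply: (@H1_adjoint_eq0_toral K L I h e
  (fun ij => idx_par (\val ij).1 (+) idx_par (\val ij).2)
  (fun ij => d 0 (\val ij).1 - d 0 (\val ij).2)).
- by rewrite mem_sub_part hE; apply: diag_mx_even.
- by case=> -[i j] ij; rewrite mem_sub_part eE; apply: F_par.
- case=> -[i j] ij /=; apply: root_multiple; rewrite vbr hE eE.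
  by apply: superbr_diag_weight => k l; apply: F_weight.
- move=> c x y hx hy; apply: val_inj; apply/matrixP => i j.
  have := congr1 (fun z : L => vsval z i j) hx; have := congr1 (fun z : L => vsval z i j) hy.
  rewrite /= !br_h !mxE.
  set a := _ - _; set X := vsval x i j; set Y := vsval y i j => aY aX.
  have [ac|ac] := eqVneq a c.
    by move: aX; rewrite ac -[LHS]addr0 => /addrI.
  by move/eqP: aY; rewrite -subr_eq0 -mulrBl mulf_eq0 subr_eq0 (negPf ac) => /eqP.
- by move=> t /torusP[v vE]; rewrite mem_sub_part vE; apply: diag_mx_even.
- move=> s t /torusP[v vE] /torusP[w wE]; apply: val_inj; rewrite /= vbr vE wE.
  rewrite superbr_diag; apply/matrixP => i j; rewrite !mxE.
  by have [->|_] := eqVneq i j; rewrite ?subrr ?mul0r ?mulr0n ?mulr0.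
- case=> -[i j] ij x /= hx.
  have [r /(_ (vsval x) (subvsP x)) xE] := F_span.
  suff [c cE] : exists c, vsval x = c *: F i j by exists c; apply: root_multiple.
  apply/vlineP; rewrite xE rpredZ // rpred_sum // => k _; rewrite rpred_sum // => l _.
  have [->|xkl] := eqVneq (vsval x k l) 0; first by rewrite scale0r mem0v.
  have [|c ->] := @F_line i j k l ij; last by rewrite !rpredZ ?memv_line.
  have := congr1 (fun z : L => vsval z k l) hx; rewrite /= br_h !mxE.
  by move/(mulIf xkl).
- move=> t /torusP[v vE] te; apply: val_inj; rewrite /= vE; apply: F_faithful.
    by rewrite -vE subvsP.
  move=> i j ij; have := congr1 vsval (te (exist _ (i, j) ij)).
  by rewrite vbr vE eE linear0.
- move=> D Dtorus De x; have [r /(_ (vsval x) (subvsP x)) xE] := F_span.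
  (* D kills y, and x - y is a combination of the F i i, hence lies in the torus. *)
  pose y : L := r *: \sum_i \sum_(j | i != j) vsval x i j *: vsproj U (F i j).
  have Dy : D y = 0.
    rewrite /y linearZ /= linear_sum big1 ?scaler0 // => i _.
    rewrite linear_sum big1 // => j ij; rewrite linearZ /=.
    by have := De (exist _ (i, j) ij); rewrite /e /= => ->; rewrite scaler0.
  have yE : vsval y = r *: \sum_i \sum_(j | i != j) vsval x i j *: F i j.
    rewrite valZ (linear_sum val); congr (_ *: _); apply: eq_bigr => i _.
    rewrite (linear_sum val); apply: eq_bigr => j ij.
    by rewrite (linearZ_LR val) /= vsprojK // F_U.
  rewrite -(subrK y x) linearD Dy addr0; apply/Dtorus/torusP.
  clearbody y.
  have dE : vsval (x - y) = r *: \sum_i vsval x i i *: F i i.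
    rewrite (linearB val) /= [in LHS]xE yE -scalerBr -sumrB; congr (_ *: _).
    apply: eq_bigr => i _; rewrite (bigD1 i) //=.
    by rewrite (eq_bigl (fun j => i != j)) ?addrK // => j; rewrite eq_sym.
  exists (\row_k vsval (x - y) k k); apply/matrixP => k l.
  have [->|kl] := eqVneq k l; first by rewrite [RHS]mxE eqxx mulr1n [RHS]mxE.
  rewrite [RHS]mxE (negPf kl) mulr0n dE.
  rewrite mxE summxE big1 ?mulr0 // => i _; rewrite mxE.
  have [->|/F_weight] := eqVneq (F i i k l) 0; first by rewrite mulr0.
  by rewrite subrr => /eqP; rewrite subr_eq0 (inj_eq d_inj) (negPf kl).
- move=> D sD Dtorus De.
  (* [F_inner] speaks of maps on all matrices, so D is extended by a projection onto U. *)
  pose Dm : {linear mx -> mx} := val \o D \o vsproj U.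
  have DmE (x : L) : Dm (vsval x) = vsval (D x) by rewrite /Dm /= vsvalK.
  have [||i j ij|v vU vE] := F_inner (D := Dm).
  + move=> A B AU BU; rewrite -(vsprojK AU) -(vsprojK BU) -vbr !DmE
      even_superderivation_br // valD.
    by rewrite !vbr.
  + by move=> v vU; rewrite -(vsprojK vU) DmE Dtorus //; apply/torusP; exists v; rewrite vsprojK.
  + have [c Dc] := De (exist _ (i, j) ij); exists c.
    by rewrite -(eE ij) DmE Dc valZ.
  exists (vsproj U (diag_mx v)); first by apply/torusP; exists v; rewrite vsprojK.
  case=> -[i j] ij; apply: val_inj; rewrite /= vbr -DmE eE vE // vsprojK //.
Qed.
End GradedSubalgebra.

(** * The algebras sl(m|n) *)

Section DeltaFacts.
Variables (K : fieldType) (m n : nat).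
Implicit Types (A B : 'M[K]_(m + n)) (v : 'rV[K]_(m + n)) (i j k l : 'I_(m + n)).

Lemma superbr_delta i j k l :
  superbr (delta_mx i j) (delta_mx k l) =
    (j == k)%:R *: delta_mx i l -
    (-1) ^+ ((idx_par i (+) idx_par j) && (idx_par k (+) idx_par l))
      *: ((l == i)%:R *: delta_mx k j) :> 'M[K]_(m + n).
Proof.
rewrite (superbrE (delta_mx_par _ _ _) (delta_mx_par _ _ _)).
by rewrite !mul_delta_mx_cond -!scaler_nat.
Qed.

Lemma superbr_diag_delta v i j :
  superbr (diag_mx v) (delta_mx i j) = (v 0 i - v 0 j) *: delta_mx i j.
Proof.
apply: superbr_diag_weight => k l; rewrite mxE.
by case: andP => [[/eqP-> /eqP->]//|_]; rewrite eqxx.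
Qed.

Lemma supertrace_delta i j :
  supertrace (delta_mx i j) = (-1) ^+ idx_par i *+ (i == j) :> K.
Proof.
rewrite /supertrace (bigD1 i) //= big1 ?addr0 => [|k /negPf ki].
  by rewrite mxE eqxx /= mulr_natr.
by rewrite mxE ki mulr0.
Qed.

Lemma supertrace_mul_delta A i j :
  supertrace (A *m delta_mx i j) = (-1) ^+ idx_par j * A j i.
Proof.
rewrite /supertrace (bigD1 j) //= big1 ?addr0 => [|k /negPf kj].
  rewrite mxE (bigD1 i) //= big1 ?addr0 => [|l /negPf li].
    by rewrite mxE !eqxx mulr1.
  by rewrite mxE li mulr0.
by rewrite mxE big1 ?mulr0 // => l _; rewrite mxE kj andbF mulr0.
Qed.

Lemma supertrace1 : supertrace (1%:M : 'M[K]_(m + n)) = m%:R - n%:R.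
Proof.
rewrite /supertrace big_split_ord /=; congr (_ + _).
  rewrite (eq_bigr (fun _ => 1)) ?sumr_const ?card_ord // => i _.
  by rewrite mxE eqxx /idx_par /= leqNgt ltn_ord mulr1.
rewrite (eq_bigr (fun _ => -1)) ?sumr_const ?card_ord ?mulNrn // => i _.
by rewrite mxE eqxx /idx_par /= leq_addr mulr1.
Qed.
End DeltaFacts.

Section Sl.
Variables (K : fieldType) (m n : nat) (d : 'rV[K]_(m + n)).
Hypothesis mn_neq : m%:R != n%:R :> K.
Hypothesis d_str : supertrace (diag_mx d) = 0.
Hypothesis d_generic : forall i j k l : 'I_(m + n), i != j ->
  d 0 k - d 0 l = d 0 i - d 0 j -> k = i /\ l = j.
Local Notation mx := 'M[K]_(m + n).

Let str1 : supertrace (1%:M : mx) != 0.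
Proof. by rewrite supertrace1 subr_eq0. Qed.

(** The scalars c_ij of a diagonal derivation satisfy c_ik = c_ij + c_jk and c_ij + c_ji = 0, so
    c_ij = g_i - g_j with g_i = c_io for a fixed index o. *)
Lemma H1_sl : H1_adjoint_eq0 (sl K m n).
Proof.
have d_inj : injective (d 0).
  move=> k l E; have [//|kl] := eqVneq k l.
  by have [|->] := d_generic (k := l) (l := k) kl; rewrite ?E.
apply: (@H1_adjoint_eq0_diagonal K m n (sl_vs K m n) (@sl_graded K m n) (@sl_br K m n)
  d (fun i j => delta_mx i j)) => //.
- by rewrite mem_sl d_str.
- by move=> i j ij; rewrite mem_sl supertrace_delta (negPf ij).
- exact: delta_mx_par.
- move=> i j k l; rewrite mxE.
  by case: andP => [[/eqP-> /eqP->]//|_]; rewrite eqxx.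
- by move=> i j k l ij E; exists 1; have [-> ->] := d_generic ij E; rewrite scale1r.
- by exists 1 => A _; rewrite scale1r -matrix_sum_delta.
- move=> v; rewrite mem_sl => /eqP v0 vF.
  have vc i j : v 0 i = v 0 j.
    have [->//|ij] := eqVneq i j; apply/eqP; rewrite -subr_eq0.
    have := vF i j ij; rewrite superbr_diag_delta => /matrixP/(_ i j)/eqP.
    by rewrite !mxE !eqxx mulr1.
  have vE i : diag_mx v = v 0 i *: 1%:M.
    by apply/matrixP => k l; rewrite !mxE (vc k i) mulr_natr.
  apply/matrixP => i j; move: v0; rewrite (vE i) linearZ /= => /eqP.
  by rewrite mulf_eq0 (negPf str1) orbF => /eqP ->; rewrite scale0r.
move=> D Dbr Dt Dc.
pose c (i j : 'I_(m + n)) : K := D (delta_mx i j) i j.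
have DE i j : i != j -> D (delta_mx i j) = c i j *: delta_mx i j.
  by move=> ij; have [k] := Dc i j ij; rewrite /c => ->; rewrite !mxE !eqxx mulr1.
have sl_delta i j : i != j -> delta_mx i j \in sl_vs K m n.
  by move=> ij; rewrite mem_sl supertrace_delta (negPf ij).
have cD i j k : i != j -> j != k -> i != k -> c i k = c i j + c j k.
  move=> ij jk ik; have := Dbr _ _ (sl_delta _ _ ij) (sl_delta _ _ jk).
  rewrite !DE // superbrZl superbrZr superbr_delta eqxx (eq_sym k) (negPf ik).
  rewrite scale0r scaler0 subr0 scale1r DE // -scalerDl => /matrixP/(_ i k).
  by rewrite !mxE !eqxx !mulr1.
(* [E_ij, E_ji] is a nonzero diagonal element of sl, which D kills. *)
have cN i j : i != j -> c i j + c j i = 0.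
  move=> ij; have ji : j != i by rewrite eq_sym.
  have := Dbr _ _ (sl_delta _ _ ij) (sl_delta _ _ ji).
  rewrite !DE // superbrZl superbrZr -scalerDl.
  set T := superbr _ _ => E.
  have TE : T = delta_mx i i - (-1) ^+ (idx_par i (+) idx_par j) *: delta_mx j j.
    by rewrite /T superbr_delta !eqxx !scale1r (addbC (idx_par j)) andbb.
  have Tdiag : T = diag_mx (\row_k T k k).
    rewrite TE; apply/matrixP => k l; rewrite !mxE.
    have [->|kl] := eqVneq k l; first by rewrite !mulr1n.
    have off p : (k == p) && (l == p) = false.
      by apply/negP => /andP[/eqP kp /eqP lp]; rewrite kp lp eqxx in kl.
    by rewrite !off mulr0 subr0.
  move: E; rewrite Tdiag Dt -?Tdiag.
    move/matrixP/(_ i i); rewrite TE !mxE !eqxx (negPf ij) /= mulr0 subr0 mulr1.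
    by [].
  by rewrite mem_sl supertrace_br.
have [o _|noI] := pickP (fun _ : 'I_(m + n) => true); last first.
  by exists 0 => [|i]; [rewrite linear0 mem0v | have := noI i].
pose g (i : 'I_(m + n)) : K := if i == o then 0 else c i o.
have cg i j : i != j -> c i j = g i - g j.
  rewrite /g => ij; case: eqP => [io|/eqP io]; case: eqP => [jo|/eqP jo].
  - by rewrite io jo eqxx in ij.
  - by apply/eqP; rewrite io sub0r -addr_eq0 cN // eq_sym.
  - by rewrite jo subr0.
  - by rewrite (cD i o j) // 1?eq_sym //; congr (_ + _); apply/eqP; rewrite -addr_eq0 cN // eq_sym.
(* Subtracting a scalar matrix changes no difference g_i - g_j; this k makes the supertrace
   vanish. *)
pose k := supertrace (diag_mx (\row_i g i)) / supertrace (1%:M : mx).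
exists (\row_i (g i - k)).
  have -> : diag_mx (\row_i (g i - k)) = diag_mx (\row_i g i) - k *: 1%:M.
    by apply/matrixP => i j; rewrite !mxE mulrnBl mulr_natr.
  by rewrite mem_sl linearB linearZ /= /GRing.scale /= divfK // subrr.
move=> i j ij; rewrite DE // superbr_diag_delta !mxE cg //; congr (_ *: _); ring.
Qed.

(** Since str 1 != 0, gl is the sum of sl and the scalars. A supertraceless A orthogonal to sl is
    also orthogonal to 1, hence to all of gl, where the form is nondegenerate. *)
Lemma H2_sl : H2_trivial_eq0 (sl K m n).
Proof.
apply: H2_trivial_sub H1_sl => A; rewrite mem_sl => /eqP A0 AU.
have AB B : supertrace (A *m B) = 0.
  pose c := supertrace B / supertrace (1%:M : mx).
  rewrite -[B](subrK (c *: 1%:M)) mulmxDr linearD /= AU ?add0r.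
    by rewrite -scalemxAr mulmx1 linearZ /= A0 scaler0.
  by rewrite mem_sl linearB linearZ /= /GRing.scale /= divfK // subrr.
apply/matrixP => i j; have /eqP := AB (delta_mx j i).
by rewrite supertrace_mul_delta mulf_eq0 signr_eq0 mxE => /eqP.
Qed.
End Sl.

(** * The algebras osp(S) for a monomial form S *)

Section OspMonomial.
Variables (K : fieldType) (m n : nat).
Local Notation mx := 'M[K]_(m + n).
Local Notation idx := 'I_(m + n).
Local Notation par := (@idx_par m n).
Variables (sg : idx -> idx) (s : idx -> K) (S : mx) (o : idx) (d : 'rV[K]_(m + n)).
Hypothesis char_neq2 : 2%:R != 0 :> K.
Hypothesis sgK : involutive sg.
Hypothesis sg_par : forall i, par (sg i) = par i.
Hypothesis sg_fix : forall i, (sg i == i) = (i == o).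
Hypothesis o_even : par o = false.
Hypothesis s_neq0 : forall i, s i != 0.
Hypothesis s_sg : forall i, s (sg i) = (-1) ^+ par i * s i.
Hypothesis SE : forall i j, S i j = s i *+ (j == sg i).
Hypothesis d_sg : forall i, d 0 (sg i) = - d 0 i.
Hypothesis d_inj : injective (d 0).
Hypothesis d_generic : forall i j k l, i != j ->
  d 0 k - d 0 l = d 0 i - d 0 j -> k = i /\ l = j \/ k = sg j /\ l = sg i.
Implicit Types (A B : mx) (i j k l : idx) (v : 'rV[K]_(m + n)).

(* The sign-and-scale factor in the equations A i j = - osp_eps i j * A (sg j) (sg i)
   cutting out osp(S), obtained from the entries of form_defect S. *)
Definition osp_eps i j : K := (-1) ^+ ((par i (+) par j) && par i) * s (sg j) / s (sg i).
Local Notation eps := osp_eps.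

(** The equations at (i, j) and at the flipped pair (sg j, sg i) are thus equivalent. *)
Lemma osp_epsK i j : eps i j * eps (sg j) (sg i) = 1.
Proof.
rewrite /osp_eps !sgK !sg_par !s_sg.
by case: (par i) (par j) => [] [] /=; field; rewrite !s_neq0 ?oppr_eq0 ?oner_eq0.
Qed.

Lemma osp_eps_sg i j : eps (sg i) (sg j) * eps (sg j) (sg i) = (-1) ^+ (par i (+) par j).
Proof.
rewrite /osp_eps !sgK !sg_par.
by case: (par i) (par j) => [] [] /=; field; rewrite !s_neq0 ?oppr_eq0 ?oner_eq0.
Qed.

Lemma osp_eps_diag i : eps i i = 1.
Proof. by rewrite /osp_eps addbb mul1r divff. Qed.

Lemma form_defectE a A i j : form_defect S a A i j =
  mxpart a A (sg j) i * s (sg j) + (-1) ^+ (a && par i) * s i * mxpart a A (sg i) j.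
Proof.
rewrite /form_defect mxE; congr (_ + _).
  rewrite mxE (bigD1 (sg j)) //= big1 ?addr0 => [|k kj].
    by rewrite mxE SE sgK eqxx mulr1n.
  by rewrite SE -(inj_eq (inv_inj sgK)) sgK eq_sym (negPf kj) mulr0n mulr0.
rewrite mxE (bigD1 (sg i)) //= big1 ?addr0 => [|k /negPf ki].
  by rewrite mul_diag_mx mxE mxE SE eqxx mulr1n.
by rewrite mul_diag_mx mxE SE ki mulr0n mulr0 mul0r.
Qed.

Lemma mem_osp_monomial A :
  (A \in osp_vs S) <-> (forall i j, A i j = - eps i j * A (sg j) (sg i)).
Proof.
rewrite mem_ospE; split=> [/forallP AS i j|AE].
  have /eqP/matrixP/(_ (sg i) j) := AS (par i (+) par j).
  rewrite form_defectE !mxE !sgK !sg_par (addbC (par j)) eqxx !mulr1n => E.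
  have c0 : (-1) ^+ ((par i (+) par j) && par i) * s (sg i) != 0.
    by rewrite mulf_neq0 ?signr_eq0.
  apply: (mulfI c0); rewrite -[LHS]subr0 -E opprD addrCA subrr addr0 /osp_eps.
  by case: (_ && _) => /=; field.
apply/forallP => a; apply/eqP/matrixP => i j.
rewrite form_defectE !mxE !sg_par (addbC (par j)).
case: eqP => [<-|_]; last by rewrite !mulr0n mulr0 mul0r addr0.
rewrite !mulr1n (AE (sg i) j) sgK /osp_eps sgK sg_par.
by case: (par i) (par j) => [] [] /=; field; rewrite !s_neq0 ?oppr_eq0 ?oner_eq0.
Qed.

(** This is E_ij symmetrized under the involution of gl whose fixed space is osp(S). It is zero when
    j = sg i with i even. *)
Definition osp_root i j : mx :=
  delta_mx i j + (- eps (sg j) (sg i)) *: delta_mx (sg j) (sg i).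
Local Notation F := osp_root.

Lemma osp_root_mem i j : F i j \in osp_vs S.
Proof.
apply/mem_osp_monomial => k l; rewrite !mxE !(inv_eq sgK) !sgK.
rewrite [(l == j) && _]andbC [(l == sg i) && _]andbC.
set P := (k == i) && _; set Q := (k == sg j) && _.
have {1}-> : P%:R = eps k l * eps (sg j) (sg i) *+ P :> K.
  by rewrite /P; case: andP => [[/eqP-> /eqP->]|//]; rewrite osp_epsK.
have -> : - eps (sg j) (sg i) * Q%:R = - eps k l * Q%:R.
  by rewrite /Q; case: andP => [[/eqP-> /eqP->]|//]; rewrite ?mulr0.
by case: P Q => [] [] /=; ring.
Qed.

Lemma osp_root_flip i j : F (sg j) (sg i) = - eps i j *: F i j.
Proof.
rewrite /osp_root !sgK scalerDr scalerA mulrNN osp_epsK scale1r.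
by rewrite addrC.
Qed.

Lemma osp_root_supp i j k l : F i j k l != 0 -> k = i /\ l = j \/ k = sg j /\ l = sg i.
Proof.
rewrite !mxE; case: andP => [[/eqP-> /eqP->]|_]; first by left.
by case: andP => [[/eqP-> /eqP->]|_]; [right | rewrite mulr0 addr0 eqxx].
Qed.

Lemma superbr_diag_root v i j : (forall k, v 0 (sg k) = - v 0 k) ->
  superbr (diag_mx v) (F i j) = (v 0 i - v 0 j) *: F i j.
Proof.
move=> v_sg; apply: superbr_diag_weight => k l /osp_root_supp[] [-> ->] //.
by rewrite !v_sg opprK addrC.
Qed.

(** Each entry of A is counted twice in the sum, once directly and once through its flipped pair. *)
Lemma osp_root_span A : A \in osp_vs S -> A = 2%:R^-1 *: \sum_i \sum_j A i j *: F i j.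
Proof.
move=> /mem_osp_monomial AE; have A2 : \sum_i \sum_j A i j *: F i j = A + A.
  rewrite [in X in _ = X + _](matrix_sum_delta A) [in X in _ = _ + X](matrix_sum_delta A).
  rewrite [X in _ = _ + X]exchange_big /= [X in _ = _ + X](reindex_inj (inv_inj sgK)) /=.
  rewrite -big_split /=; apply: eq_bigr => i _.
  rewrite [X in _ = _ + X](reindex_inj (inv_inj sgK)) /=.
  rewrite -big_split /=; apply: eq_bigr => j _.
  rewrite scalerDr scalerA; congr (_ + _ *: _).
  by rewrite (AE (sg j)) !sgK mulrC.
by rewrite A2 -mulr2n -[A *+ 2]scaler_nat scalerA mulVf // scale1r.
Qed.

Lemma osp_root_diag_neq0 i : i != o -> F i i i i = 1.
Proof. by move=> io; rewrite !mxE !eqxx eq_sym sg_fix (negPf io) mulr0 addr0. Qed.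

Lemma osp_root_o_neq0 i : i != o -> F i o i o = 1.
Proof.
have sgo : sg o = o by apply/eqP; rewrite sg_fix.
by move=> io; rewrite !mxE !eqxx sgo (negPf io) mulr0 addr0.
Qed.

(** The root vectors through o therefore generate, and a derivation is controlled by its values on
    them. *)
Lemma superbr_root_o i j : i != o -> j != o -> superbr (F i o) (F o j) = F i j.
Proof.
move=> io jo; have sgo : sg o = o by apply/eqP; rewrite sg_fix.
have sg_o k : k != o -> (o == sg k) = false.
  by move=> ko; rewrite -(inj_eq (inv_inj sgK)) sgK sgo eq_sym (negPf ko).
rewrite /osp_root sgo !(superbrDl, superbrDr, superbrZl, superbrZr) !superbr_delta.
rewrite !eqxx !(eq_sym _ o) !sg_o // (eq_sym o i) (eq_sym o j) (negPf io) (negPf jo).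
rewrite !scale0r !scaler0 !subr0 ?subrr !scaler0 !addr0 ?add0r !scale1r.
rewrite !sg_par o_even !addbF !addFb (inj_eq (inv_inj sgK)).
apply/matrixP => k l; rewrite !mxE.
rewrite /osp_eps !sgK !sg_par sgo o_even andbF addbF /= (eq_sym j i).
(* For i = j two multiples of E_oo also appear; they cancel. *)
case: (eqVneq i j) => [<-|_].
  by case: (par i) => /=; field; rewrite !s_neq0 ?oppr_eq0 ?oner_eq0.
by case: (par i) (par j) => [] [] /=; field; rewrite !s_neq0 ?oppr_eq0 ?oner_eq0.
Qed.

Let diag_osp v : diag_mx v \in osp_vs S <-> forall k, v 0 (sg k) = - v 0 k.
Proof.
rewrite mem_osp_monomial; split=> [vE k|vE k l].
  have := vE k k; rewrite !mxE !eqxx !mulr1n osp_eps_diag mulN1r => ->.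
  by rewrite opprK.
rewrite !mxE (inj_eq (inv_inj sgK)) (eq_sym l).
have [->|_] := eqVneq k l; last by rewrite !mulr0n mulr0.
by rewrite !mulr1n osp_eps_diag mulN1r vE opprK.
Qed.

Let oppr_fix (x : K) : x = - x -> x = 0.
Proof.
move/eqP; rewrite -addr_eq0 -mulr2n -mulr_natr mulf_eq0 (negPf char_neq2) orbF.
by move/eqP.
Qed.

Let sgo : sg o = o. Proof. by apply/eqP; rewrite sg_fix. Qed.

(** Let g_i be the scalar of D on F i o. As F o j is proportional to F (sg j) o, D scales F i j by
    g_i + g_(sg j). The diagonal F i i is killed, so g_(sg i) = - g_i, which says exactly that diag
    g lies in osp(S). *)
Lemma H1_osp_monomial : H1_adjoint_eq0 (osp S).
Proof.
apply: (@H1_adjoint_eq0_diagonal K m n (osp_vs S) (@osp_graded K m n S)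
  (@osp_br K m n S) d F) => //.
- exact/diag_osp.
- by move=> i j _; apply: osp_root_mem.
- move=> i j; rewrite rpredD ?rpredZ ?delta_mx_par //.
  by rewrite -(sg_par i) -(sg_par j) addbC delta_mx_par.
- by move=> i j k l /osp_root_supp[] [-> ->] //; rewrite !d_sg opprK addrC.
- move=> i j k l ij /(d_generic ij)[] [-> ->]; first by exists 1; rewrite scale1r.
  by exists (- eps i j); rewrite osp_root_flip.
- by exists (2%:R^-1); apply: osp_root_span.
- move=> v /diag_osp v_sg vF.
  have vo : v 0 o = 0 by apply: oppr_fix; rewrite -v_sg sgo.
  have v0 i : v 0 i = 0.
    have [->//|io] := eqVneq i o.
    have := vF i o io; rewrite superbr_diag_root // vo subr0 => /matrixP/(_ i o).
    by rewrite mxE osp_root_o_neq0 // mulr1 mxE.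
  by apply/matrixP => i j; rewrite !mxE v0 mul0rn.
move=> D Dbr Dt Dc.
pose g i : K := if i == o then 0 else D (F i o) i o.
have Dio i : i != o -> D (F i o) = g i *: F i o.
  move=> io; have [c] := Dc i o io; rewrite /g (negPf io) => ->.
  by rewrite mxE osp_root_o_neq0 // mulr1.
have Doj j : j != o -> D (F o j) = g (sg j) *: F o j.
  move=> jo; have -> : F o j = - eps (sg j) o *: F (sg j) o.
    by rewrite -{1}sgo -{1}(sgK j) osp_root_flip.
  rewrite linearZ /= Dio; first by rewrite !scalerA mulrC.
  by rewrite -sgo (inj_eq (inv_inj sgK)).
have Dij i j : i != o -> j != o -> D (F i j) = (g i + g (sg j)) *: F i j.
  move=> io jo; rewrite -superbr_root_o // Dbr ?osp_root_mem // Dio // Doj //.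
  by rewrite superbrZl superbrZr -scalerDl.
have g_sg i : g (sg i) = - g i.
  have [->|io] := eqVneq i o; first by rewrite sgo /g eqxx oppr0.
  have := Dij i i io io.
  have Fdiag : F i i = diag_mx (\row_k F i i k k).
    apply/matrixP => k l; rewrite [RHS]mxE [in RHS]mxE.
    have [->|kl] := eqVneq k l; first by rewrite mulr1n.
    rewrite mulr0n; apply/eqP; apply: contraNT kl => /osp_root_supp.
    by case=> [] [-> ->].
  have -> : D (F i i) = 0 by rewrite Fdiag Dt -?Fdiag ?osp_root_mem.
  move=> /matrixP/(_ i i); rewrite mxE [RHS]mxE osp_root_diag_neq0 // mulr1.
  by move=> /esym/eqP; rewrite addrC addr_eq0 => /eqP.
exists (\row_i g i); first by apply/diag_osp => k; rewrite !mxE.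
move=> i j ij; rewrite superbr_diag_root => [|k]; last by rewrite !mxE.
rewrite !mxE; have [io|io] := eqVneq i o; have [jo|jo] := eqVneq j o.
- by rewrite io jo eqxx in ij.
- by rewrite io Doj // g_sg {2}/g eqxx sub0r.
- by rewrite jo Dio // {3}/g eqxx subr0.
- by rewrite Dij // g_sg.
Qed.

(** Pairing A with F j i yields twice the entry A i j up to sign: both terms of the root vector
    contribute equally. *)
Lemma H2_osp_monomial : H2_trivial_eq0 (osp S).
Proof.
apply: H2_trivial_sub H1_osp_monomial => A /mem_osp_monomial AE AB.
apply/matrixP => i j; have := AB _ (osp_root_mem j i).
rewrite /osp_root mulmxDr linearD /= -scalemxAr linearZ /= !supertrace_mul_delta.
rewrite /GRing.scale /= (AE (sg j) (sg i)) !sgK sg_par mxE.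
have -> : - eps (sg i) (sg j) * ((-1) ^+ par j * (- eps (sg j) (sg i) * A i j)) =
  (eps (sg i) (sg j) * eps (sg j) (sg i)) * ((-1) ^+ par j * A i j) by ring.
rewrite osp_eps_sg mulrA -signr_addb addbK -mulr2n -mulr_natr => /eqP.
by rewrite !mulf_eq0 signr_eq0 (negPf char_neq2) orbF => /eqP.
Qed.
End OspMonomial.

(** * Conjugation of osp(S) *)

Section Conjugation.
Variables (K : fieldType) (m n : nat).
Local Notation mx := 'M[K]_(m + n).
Implicit Types A B P Q S : mx.

Lemma mxpart_mul_evenl a P A : P \in gl_part K m n false ->
  mxpart a (P *m A) = P *m mxpart a A.
Proof.
move=> P0; rewrite [A in LHS](mxpart_sum A) mulmxDr linearD /=.
rewrite !(gl_part_homog _ (gl_part_mul P0 (mxpart_gl _ A))).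
by case: a; rewrite /= ?addr0 ?add0r.
Qed.

Lemma mxpart_mul_evenr a P A : P \in gl_part K m n false ->
  mxpart a (A *m P) = mxpart a A *m P.
Proof.
move=> P0; rewrite [A in LHS](mxpart_sum A) mulmxDl linearD /=.
rewrite !(gl_part_homog _ (gl_part_mul (mxpart_gl _ A) P0)).
by case: a; rewrite /= ?addr0 ?add0r.
Qed.

(** The even part of the inverse is again a right inverse of P, because 1 is even. *)
Lemma invmx_even P : P \in unitmx -> P \in gl_part K m n false ->
  invmx P \in gl_part K m n false.
Proof.
move=> Pu P0; rewrite mem_gl_part; apply/eqP/(can_inj (mulKmx Pu)).
rewrite -mxpart_mul_evenl // mulmxV //.
have /eqP <- : mxpart false (1%:M : mx) == 1%:M by rewrite -mem_gl_part -diag_const_mx diag_mx_even.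
by rewrite mxpart_id.
Qed.

Lemma sgn_mxC a P : P \in gl_part K m n false ->
  P^T *m sgn_mx K m n a = sgn_mx K m n a *m P^T.
Proof.
rewrite mem_gl_part => /eqP <-; apply/matrixP => i j.
rewrite mul_mx_diag mul_diag_mx !mxE mulrC.
have [E|_] := eqVneq (idx_par j (+) idx_par i) false; last by rewrite mulr0n !mulr0.
by move: E; case: (idx_par i) (idx_par j) => [] [].
Qed.

Section Iso.
Variables (P Q S S' : mx).
Hypotheses (P_even : P \in gl_part K m n false) (Q_even : Q \in gl_part K m n false).
Hypotheses (PQ : P *m Q = 1%:M) (S'E : S' = P^T *m S *m P).

(** Q is the inverse of P, kept as a separate variable so that the lemmas apply in both
    directions. *)
Definition conj_by A : mx := P *m A *m Q.

Fact conj_by_linear : linear conj_by.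
Proof.
by move=> c A B; rewrite /conj_by mulmxDr mulmxDl -scalemxAr -scalemxAl.
Qed.
HB.instance Definition _ := GRing.isLinear.Build K mx mx _ conj_by conj_by_linear.

Let QP : Q *m P = 1%:M. Proof. exact: mulmx1C. Qed.

Lemma conj_by_mxpart a A : mxpart a (conj_by A) = conj_by (mxpart a A).
Proof. by rewrite /conj_by mxpart_mul_evenr // mxpart_mul_evenl. Qed.

Lemma conj_by_br A B : conj_by (superbr A B) = superbr (conj_by A) (conj_by B).
Proof.
rewrite /superbr linear_sum; apply: eq_bigr => a _.
rewrite linear_sum; apply: eq_bigr => b _.
rewrite linearB linearZ /= !conj_by_mxpart /conj_by.
have E X Y : P *m X *m Q *m (P *m Y *m Q) = P *m (X *m Y) *m Q.
  by rewrite !mulmxA -(mulmxA _ Q P) QP mulmx1.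
by rewrite !E.
Qed.

(** Multiplied by P^T on the left and P on the right, the defect of P A Q for S becomes the defect
    of A for S'. *)
Lemma conj_by_osp A : A \in osp_vs S' -> conj_by A \in osp_vs S.
Proof.
rewrite !mem_ospE => /forallP AS; apply/forallP => a.
have := eqP (AS a); rewrite /form_defect conj_by_mxpart S'E; set X := mxpart a A => E.
have [Pu _] := mulmx1_unit PQ.
have PTu : P^T \in unitmx by rewrite unitmx_tr.
apply/eqP/(can_inj (mulKmx PTu))/(can_inj (mulmxK Pu)).
rewrite mulmx0 mul0mx -E mulmxDr mulmxDl /conj_by !mulmxA sgn_mxC // -!trmx_mul.
by rewrite -[_ *m P *m _ *m Q *m P]mulmxA QP mulmx1 -!mulmxA QP !mulmx1 !mulmxA.
Qed.
End Iso.

Lemma osp_conjugate P S : P \in unitmx -> P \in gl_part K m n false ->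
  H1_adjoint_eq0 (osp (P^T *m S *m P)) /\ H2_trivial_eq0 (osp (P^T *m S *m P)) ->
  H1_adjoint_eq0 (osp S) /\ H2_trivial_eq0 (osp S).
Proof.
move=> Pu P0; set S' := P^T *m S *m P.
have Q0 := invmx_even Pu P0; set Q := invmx P in Q0.
have PQ : P *m Q = 1%:M by rewrite mulmxV.
have QP : Q *m P = 1%:M by rewrite mulVmx.
have SE : S = Q^T *m S' *m Q.
  by rewrite /S' !mulmxA -trmx_mul PQ trmx1 mul1mx -mulmxA PQ mulmx1.
pose f : {linear osp S' -> osp S} :=
  vsproj (osp_vs S) \o (conj_by P Q) \o (vsval : subvs_of (osp_vs S') -> mx).
pose g : {linear osp S -> osp S'} :=
  vsproj (osp_vs S') \o (conj_by Q P) \o (vsval : subvs_of (osp_vs S) -> mx).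
have fE x : vsval (f x) = conj_by P Q (vsval x).
  by rewrite /f /= vsprojK // (conj_by_osp P0 Q0 PQ (erefl S')) // subvsP.
have gE x : vsval (g x) = conj_by Q P (vsval x).
  by rewrite /g /= vsprojK // (conj_by_osp Q0 P0 QP SE) // subvsP.
have conjK R T A : T *m R = 1%:M -> conj_by T R (conj_by R T A) = A.
  by move=> TR; rewrite /conj_by !mulmxA TR mul1mx -mulmxA TR mulmx1.
have fK : cancel f g by move=> x; apply: val_inj; rewrite /= gE fE conjK.
have gK : cancel g f by move=> x; apply: val_inj; rewrite /= fE gE conjK.
have fp a x : x \in lsa_part (osp S') a -> f x \in lsa_part (osp S) a.
  rewrite !mem_sub_part fE !mem_gl_part conj_by_mxpart //.
  by move/eqP->.
have fb x y : f (lsa_br (osp S') x y) = lsa_br (osp S) (f x) (f y).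
  apply: val_inj; rewrite /= fE.
  have vS z w : vsval (lsa_br (osp S) z w) = superbr (vsval z) (vsval w).
    exact: (@val_sub_br _ (gl K m n) _ (@osp_br K m n S) z w).
  have vS' z w : vsval (lsa_br (osp S') z w) = superbr (vsval z) (vsval w).
    exact: (@val_sub_br _ (gl K m n) _ (@osp_br K m n S') z w).
  by rewrite vS' vS !fE conj_by_br.
case=> H1 H2; split; first exact: H1_adjoint_eq0_iso fK gK fp fb H1.
exact: H2_trivial_eq0_iso fK gK fp fb H2.
Qed.
End Conjugation.

(** * Hyperbolic bases of a supersymmetric form *)

Section SuperForm.
Variables (K : fieldType) (m n : nat) (S : 'M[K]_(m + n)).
Hypothesis S_form : super_form S.
Hypothesis char_neq2 : 2%:R != 0 :> K.
Local Notation cv := 'cV[K]_(m + n).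
Local Notation G := (gram_form S).
Local Notation par := (@idx_par m n).
Implicit Types (x y z u v w : cv) (a b : bool).

Lemma gramDl x y z : G (x + y) z = G x z + G y z.
Proof. by rewrite /gram_form linearD /= !mulmxDl mxE. Qed.
Lemma gramDr x y z : G x (y + z) = G x y + G x z.
Proof. by rewrite /gram_form mulmxDr mxE. Qed.
Lemma gramZl c x y : G (c *: x) y = c * G x y.
Proof. by rewrite /gram_form linearZ /= -!scalemxAl mxE. Qed.
Lemma gramZr c x y : G x (c *: y) = c * G x y.
Proof. by rewrite /gram_form -scalemxAr mxE. Qed.

Definition gramE := (gramDl, gramDr, gramZl, gramZr).

Lemma gram_sym a x y : cvpar a x -> cvpar a y -> G y x = (-1) ^+ a * G x y.
Proof. by case: S_form => _ sym _ xa ya; rewrite (sym _ _ _ _ ya xa) andbb. Qed.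

Lemma gram_parity a b x y : cvpar a x -> cvpar b y -> a != b -> G x y = 0.
Proof. by case: S_form => par0 _ _; apply: par0. Qed.

Lemma gram_odd x : cvpar true x -> G x x = 0.
Proof.
move=> x1; have := gram_sym x1 x1; rewrite mulN1r => /eqP.
by rewrite -addr_eq0 -mulr2n -mulr_natr mulf_eq0 (negPf char_neq2) orbF => /eqP.
Qed.

Lemma cvpar_delta i : cvpar (par i) (delta_mx i 0 : cv).
Proof. by move=> j; rewrite mxE andbT; have [->|//] := eqVneq j i; rewrite eqxx. Qed.

Lemma cvparD a x y : cvpar a x -> cvpar a y -> cvpar a (x + y).
Proof. by move=> xa ya i ia; rewrite mxE xa // ya // addr0. Qed.

Lemma cvparZ a c x : cvpar a x -> cvpar a (c *: x).
Proof. by move=> xa i ia; rewrite mxE xa // mulr0. Qed.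

Lemma gram_nondeg a x : cvpar a x -> x != 0 ->
  exists2 i, par i = a & G x (delta_mx i 0) != 0.
Proof.
case: S_form => _ _ nondeg xa x0.
have [/existsP[i xi]|/existsPn none] := boolP [exists i, G x (delta_mx i 0) != 0].
  exists i => //; have [//|ia] := eqVneq (par i) a.
  by rewrite (gram_parity xa (@cvpar_delta i)) 1?eq_sym ?eqxx in xi.
case/eqP: x0; apply: nondeg => y; rewrite /gram_form.
suff -> : x^T *m S = 0 by rewrite mul0mx mxE.
apply/matrixP => k i; rewrite ord1 [RHS]mxE.
by have := none i; rewrite /gram_form -colE mxE negbK => /eqP.
Qed.

(** Take y pairing with v and add c v with G(y, y) + 2 c G(v, y) = 0; the pairing with v is
    unchanged because v is isotropic. *)
Lemma hyperbolic_partner a v : cvpar a v -> v != 0 -> G v v = 0 ->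
  exists w, [/\ cvpar a w, G w w = 0 & G v w != 0].
Proof.
move=> va v0 vv; have [i ia vi] := gram_nondeg va v0.
set y : cv := delta_mx i 0 in vi; have ya : cvpar a y by rewrite -ia; apply: cvpar_delta.
exists (y + (- (G y y / (2%:R * G v y))) *: v); split.
- by apply: cvparD => //; apply: cvparZ.
- rewrite !gramE vv (gram_sym va ya).
  case: a ya {va ia} => ya; first by rewrite (gram_odd ya); ring.
  by field; rewrite vi char_neq2.
- by rewrite !gramE vv mulr0 addr0.
Qed.

(** Project a vector pairing with x away from the hyperbolic plane of u and v; x is orthogonal to
    that plane, so its pairing survives. *)
Lemma hyperbolic_complement a u v x : cvpar a u -> cvpar a v -> cvpar a x ->
  G u u = 0 -> G v v = 0 -> G u v != 0 -> x != 0 -> G x u = 0 -> G x v = 0 ->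
  exists w, [/\ cvpar a w, G w u = 0, G w v = 0 & G x w != 0].
Proof.
move=> ua va xa uu vv uv x0 xu xv; have [i ia xi] := gram_nondeg xa x0.
set y : cv := delta_mx i 0 in xi; have ya : cvpar a y by rewrite -ia; apply: cvpar_delta.
exists (y + (- (G y v / G u v)) *: u + (- (G y u / G v u)) *: v).
have vu0 : G v u != 0 by rewrite (gram_sym ua va) mulf_neq0 ?signr_eq0.
split.
- by do !apply: cvparD => //; apply: cvparZ.
- by rewrite !gramE uu; field; rewrite ?uv ?vu0.
- by rewrite !gramE vv; field; rewrite ?uv ?vu0.
- by rewrite !gramE xu xv !mulr0 !addr0.
Qed.

(** Two linear conditions on a space of dimension above 2 have a nonzero solution; E below embeds
    K^r as the part of parity a. *)
Lemma gram_kernel a u v : (2 < if a then n else m)%N ->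
  exists x, [/\ cvpar a x, x != 0, G x u = 0 & G x v = 0].
Proof.
pose r := if a then n else m.
have [E [Ea E0]] : exists E : 'M[K]_(r, m + n),
    (forall z : 'rV_r, cvpar a (z *m E)^T) /\ (forall z : 'rV_r, z *m E = 0 -> z = 0).
  rewrite /r; case: (a).
    exists (row_mx 0 1%:M); split=> z; last first.
      by rewrite mul_mx_row mulmx1 -row_mx0 => /eq_row_mx[].
    move=> i; rewrite mul_mx_row mulmx0 mulmx1 mxE.
    by case: (split_ordP i) => k -> ; rewrite ?row_mxEl ?mxE // /idx_par /= leq_addr.
  exists (row_mx 1%:M 0); split=> z; last first.
    by rewrite mul_mx_row mulmx1 -row_mx0 => /eq_row_mx[].
  move=> i; rewrite mul_mx_row mulmx0 mulmx1 mxE.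
  by case: (split_ordP i) => k -> ; rewrite ?row_mxEr ?mxE // /idx_par /= leqNgt ltn_ord.
rewrite -/r => r2; pose N := E *m S *m row_mx u v.
have /rowV0Pn[z zN z0] : kermx N != 0.
  rewrite -mxrank_eq0 mxrank_ker -lt0n subn_gt0.
  exact: leq_ltn_trans (rank_leq_col N) r2.
have zN0 : z *m N = 0 by apply/sub_kermxP.
exists (z *m E)^T.
have zE : z *m E *m S *m row_mx u v = 0 by rewrite -zN0 /N !mulmxA.
have /eq_row_mx[zu zv] : row_mx (z *m E *m S *m u) (z *m E *m S *m v) = row_mx 0 0.
  by rewrite -mul_mx_row zE row_mx0.
split.
- exact: Ea.
- by apply: contraNneq z0 => /(congr1 trmx); rewrite trmxK trmx0 => /E0 ->.
- by rewrite /gram_form trmxK zu mxE.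
- by rewrite /gram_form trmxK zv mxE.
Qed.

Variables (sg : 'I_(m + n) -> 'I_(m + n)) (o : 'I_(m + n)) (d : 'rV[K]_(m + n)).
Variable p : 'I_(m + n) -> cv.
Hypothesis sgK : involutive sg.
Hypothesis sg_par : forall i, par (sg i) = par i.
Hypothesis sg_fix : forall i, (sg i == i) = (i == o).
Hypothesis o_even : par o = false.
Hypothesis d_sg : forall i, d 0 (sg i) = - d 0 i.
Hypothesis d_inj : injective (d 0).
Hypothesis d_generic : forall i j k l, i != j ->
  d 0 k - d 0 l = d 0 i - d 0 j -> k = i /\ l = j \/ k = sg j /\ l = sg i.
Hypothesis p_par : forall i, cvpar (par i) (p i).
Hypothesis p_orth : forall i j, j != sg i -> G (p i) (p j) = 0.
Hypothesis p_dual : forall i, G (p i) (p (sg i)) != 0.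

(** The matrix P with columns p_j is even and turns S into a monomial Gram matrix, so conjugation
    reduces to the monomial case. *)
Lemma osp_cohomology_of_basis : H1_adjoint_eq0 (osp S) /\ H2_trivial_eq0 (osp S).
Proof.
pose P : 'M[K]_(m + n) := \matrix_(i, j) p j i 0.
pose s i := G (p i) (p (sg i)).
have P_even : P \in gl_part K m n false.
  rewrite mem_gl_part; apply/eqP/matrixP => i j; rewrite !mxE.
  by case: eqP => // /eqP ij; rewrite p_par //; move: ij; case: (par i) (par j) => [] [].
have SE i j : (P^T *m S *m P) i j = s i *+ (j == sg i).
  have -> : (P^T *m S *m P) i j = G (p i) (p j).
    rewrite /gram_form !mxE; apply: eq_bigr => k _; rewrite !mxE; congr (_ * _).
    by apply: eq_bigr => l _; rewrite !mxE.
  by rewrite /s; case: eqP => [->//|/eqP/p_orth].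
have s_sg i : s (sg i) = (-1) ^+ par i * s i.
  by rewrite /s sgK; apply: gram_sym; rewrite // -sg_par.
have Pu : P \in unitmx.
  (* The monomial matrix has an explicit inverse, which forces P to be invertible. *)
  have : P^T *m S *m P *m \matrix_(i, j) ((s j)^-1 *+ (i == sg j)) = 1%:M.
    apply/matrixP => i j; rewrite !mxE (bigD1 (sg i)) //= big1 ?addr0 => [|k ki].
      rewrite SE eqxx !mxE (inj_eq (inv_inj sgK)).
      by case: eqP => [->|_]; rewrite ?mulfV ?p_dual // mulr0n mulr0.
    by rewrite SE (negPf ki) mul0r.
  by case/mulmx1_unit; rewrite unitmx_mul => /andP[].
apply: (osp_conjugate Pu P_even); split.
  exact: (H1_osp_monomial char_neq2 sgK sg_par sg_fix o_even p_dual s_sg SE).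
exact: (H2_osp_monomial char_neq2 sgK sg_par sg_fix o_even p_dual s_sg SE).
Qed.
End SuperForm.

(** * A diagonal element separating the roots *)

Section Generic.
Variables (K : closedFieldType) (p : nat).
Hypotheses (charK : p \in [pchar K]) (p_gt3 : (3 < p)%N).

(* p = 4 is excluded by primality, so p > 4. *)
Lemma small_int_eq0 (z : int) : (`|z| <= 4)%N -> z%:~R = 0 :> K -> z = 0.
Proof.
move=> z4 /eqP; rewrite -(dvdz_pcharf charK) /dvdz /= => pz.
apply/eqP; rewrite -absz_eq0; apply: contraTT p_gt3; rewrite -lt0n => z0.
have p4 := leq_trans (dvdn_leq z0 pz) z4.
have := pcharf_prime charK; rewrite -leqNgt.
by case: p p4 => [|[|[|[|[|q]]]]].
Qed.

Lemma artin_schreier_root : exists t : K, t ^+ p = t + 1.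
Proof.
have p0 : (0 < p)%N by rewrite prime_gt0 ?(pcharf_prime charK).
have [t tE] := solve_monicpoly (fun i => (i < 2)%:R : K) p0.
exists t; rewrite tE; case: p p_gt3 => [|[|q]] // _.
rewrite !big_ord_recl big1 => [|i _]; last by rewrite /= mul0r.
by rewrite /= !mul1r expr0 expr1 addr0 addrC.
Qed.

Variable t : K.
Hypothesis tp : t ^+ p = t + 1.

(** Frobenius fixes integers and sends t to t + 1, so raising the relation to the power p and
    subtracting gives y = 0 in K. *)
Lemma generic_combination_eq0 (x y : int) : (`|x| <= 4)%N -> (`|y| <= 4)%N ->
  x%:~R + y%:~R * t = 0 -> x = 0 /\ y = 0.
Proof.
move=> x4 y4 E; have [y0|y0] := eqVneq (y%:~R : K) 0.
  by split; apply: small_int_eq0 => //; move: E; rewrite y0 mul0r addr0.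
have frob (z : int) : (z%:~R : K) ^+ p = z%:~R.
  by have := rmorph_int (pFrobenius_aut charK) z.
have : (x%:~R + y%:~R * t) ^+ p = 0 by rewrite E expr0n; case: p p_gt3.
rewrite -(pFrobenius_autE charK) rmorphD rmorphM !rmorph_int /= pFrobenius_autE tp.
by rewrite mulrDr mulr1 addrA E add0r => /eqP; rewrite (negPf y0).
Qed.

Lemma char_neq0 k : (0 < k)%N -> (k <= 4)%N -> k%:R != 0 :> K.
Proof.
move=> k0 k4; apply/eqP => E; have := @small_int_eq0 k k4 E.
by case: k k0 {k4 E}.
Qed.

End Generic.

Section Weights.
Variables (K : closedFieldType) (p : nat).
Hypotheses (charK : p \in [pchar K]) (p_gt3 : (3 < p)%N).
Variable t : K.
Hypothesis tp : t ^+ p = t + 1.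

Definition weights (a b : seq int) N : 'rV[K]_N := \row_i ((a`_i)%:~R + (b`_i)%:~R * t).

Lemma weights_eq (a b : seq int) N (i j k l : 'I_N) :
  all (fun x : int => `|x| <= 1)%N a -> all (fun x : int => `|x| <= 1)%N b ->
  weights a b N 0 k - weights a b N 0 l = weights a b N 0 i - weights a b N 0 j ->
  a`_k - a`_l = a`_i - a`_j /\ b`_k - b`_l = b`_i - b`_j.
Proof.
move=> a1 b1; rewrite !mxE.
have small (s : seq int) (q : nat) : all (fun x : int => `|x| <= 1)%N s -> (`|(s`_q)%R| <= 1)%N.
  move=> /allP s1; have [/(mem_nth 0)/s1//|] := ltnP q (size s).
  by move/(nth_default 0)->.
have := small _ k a1; have := small _ l a1; have := small _ i a1; have := small _ j a1.
have := small _ k b1; have := small _ l b1; have := small _ i b1; have := small _ j b1.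
move: (a`_i) (a`_j) (a`_k) (a`_l) (b`_i) (b`_j) (b`_k) (b`_l).
move=> x y z w x' y' z' w' h1 h2 h3 h4 h5 h6 h7 h8 E.
(* A signed sum of four entries of absolute value at most 1 stays within the bound 4. *)
have [|||e1 e2] := @generic_combination_eq0 _ _ charK p_gt3 _ tp
  (z - w - x + y) (z' - w' - x' + y').
- lia.
- lia.
- apply/eqP; rewrite !intrD !intrN; apply/eqP.
  transitivity ((z%:~R + z'%:~R * t - (w%:~R + w'%:~R * t)) - 
    (x%:~R + x'%:~R * t - (y%:~R + y'%:~R * t)) : K); first by ring.
  by rewrite E subrr.
- by split; lia.
Qed.

End Weights.

(* Basis vector 0 is orthogonal to the others, 1 is paired with 2, and 3 with 4;
   this serves both 3|2 and 1|4. *)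
Definition pairing_seq : seq nat := [:: 0; 2; 1; 4; 3]%N.
Definition pairing (i : 'I_5) : 'I_5 := inord (nth 0%N pairing_seq i).

(** Reduces finite checks on ordinals to closed boolean computations on naturals. *)
Lemma ord_all N (P : pred nat) : all P (iota 0 N) -> forall i : 'I_N, P i.
Proof. by move=> /allP h i; apply: h; rewrite mem_iota ltn_ord. Qed.

Lemma pairingE (i : 'I_5) : pairing i = nth 0%N pairing_seq i :> nat.
Proof. by rewrite inordK //; apply: (ord_all (P := fun i => nth 0%N pairing_seq i < 5)%N). Qed.

Lemma pairingK : involutive pairing.
Proof.
move=> i; apply: val_inj; rewrite /= !pairingE; apply/eqP; move: i.
exact: (ord_all (P := fun i => nth 0%N pairing_seq (nth 0%N pairing_seq i) == i)).
Qed.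

(** [weight1] and [weightt] are the two coordinates of the weights 0, e1, -e1, e2, -e2 of the
    standard module under a rank 2 torus. *)
Definition weight1 : seq int := [:: 0; 1; -1; 0; 0].
Definition weightt : seq int := [:: 0; 0; 0; 1; -1].

Lemma weights_pairing (i : 'I_5) :
  weight1`_(pairing i) = - weight1`_i /\ weightt`_(pairing i) = - weightt`_i.
Proof.
pose P k := (weight1`_(nth 0%N pairing_seq k) == - weight1`_k)
  && (weightt`_(nth 0%N pairing_seq k) == - weightt`_k).
by have /andP[/eqP ea /eqP eb] := ord_all (isT : all P (iota 0 5)) i; rewrite pairingE.
Qed.

Lemma pairing_generic (i j k l : 'I_5) : i != j ->
  weight1`_k - weight1`_l = weight1`_i - weight1`_j ->
  weightt`_k - weightt`_l = weightt`_i - weightt`_j ->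
  k = i /\ l = j \/ k = pairing j /\ l = pairing i.
Proof.
move=> ij /eqP ea /eqP eb; pose sq := nth 0%N pairing_seq.
pose P (i j k l : nat) := (i != j) ==> (weight1`_k - weight1`_l == weight1`_i - weight1`_j) ==>
  (weightt`_k - weightt`_l == weightt`_i - weightt`_j) ==>
  ((k == i) && (l == j) || (k == sq j) && (l == sq i)).
have PT : all (fun i => all (fun j => all (fun k => all (P i j k) (iota 0 5)) (iota 0 5))
  (iota 0 5)) (iota 0 5) by vm_compute.
have := ord_all (ord_all (ord_all (ord_all PT i) j) k) l.
rewrite /P (_ : (i != j :> nat) = true) ?ea ?eb //= -?pairingE.
by case/orP=> /andP[/eqP ki /eqP lj]; [left | right]; split; apply: val_inj;
  rewrite /= ?pairingE.
Qed.

(** * The three algebras *)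

Lemma pairing_fix (i : 'I_5) : (pairing i == i) = (i == ord0).
Proof.
have /eqP := @ord_all 5 (fun k => (nth 0 pairing_seq k == k) == (k == 0))%N isT i.
by rewrite -!val_eqE /= pairingE.
Qed.

Section Main.
Variables (K : closedFieldType) (p : nat).
Hypotheses (charK : p \in [pchar K]) (p_gt3 : (3 < p)%N).
Variable t : K.
Hypothesis tp : t ^+ p = t + 1.

Let char2 : 2%:R != 0 :> K. Proof. exact: (char_neq0 charK). Qed.

Let dvec : 'rV[K]_5 := weights t weight1 weightt 5.

Let dvec_sg (i : 'I_5) : dvec 0 (pairing i) = - dvec 0 i.
Proof.
have [ea eb] := weights_pairing i.
by rewrite /dvec !mxE ea eb !intrN mulNr opprD.
Qed.

Let dvec_generic (i j k l : 'I_5) : i != j ->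
  dvec 0 k - dvec 0 l = dvec 0 i - dvec 0 j -> k = i /\ l = j \/ k = pairing j /\ l = pairing i.
Proof.
move=> ij E; have [//|//|ea eb] := weights_eq charK p_gt3 tp _ _ E.
exact: pairing_generic.
Qed.

Let dvec_inj : injective (dvec 0).
Proof.
move=> k l E; have [//|kl] := eqVneq k l.
have lk : l != k by rewrite eq_sym.
(* Equal entries make both differences zero; genericity then leaves k = l or both fixed by the
   pairing, hence both 0. *)
have [|[-> //]|[ll kk]] := @dvec_generic k l l k kl; first by rewrite E.
have fix_ord0 (i : 'I_5) : i = pairing i -> i = ord0.
  by move/eqP; rewrite eq_sym pairing_fix => /eqP.
by rewrite (fix_ord0 l ll) (fix_ord0 k kk).
Qed.

Let isotropic_even n (S : 'M[K]_(3 + n)) : super_form S ->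
  exists u : 'cV[K]_(3 + n), [/\ cvpar false u, u != 0 & gram_form S u u = 0].
Proof.
move=> Sf; pose i0 : 'I_(3 + n) := lshift n (@Ordinal 3 0 isT).
pose i1 : 'I_(3 + n) := lshift n (@Ordinal 3 1 isT).
pose e0 : 'cV[K]_(3 + n) := delta_mx i0 0; pose e1 : 'cV[K]_(3 + n) := delta_mx i1 0.
have e0p : cvpar false e0 := @cvpar_delta K 3 n i0.
have e1p : cvpar false e1 := @cvpar_delta K 3 n i1.
have [a0|a0] := eqVneq (gram_form S e0 e0) 0.
  exists e0; split=> //; apply/eqP => /matrixP/(_ i0 0)/eqP.
  by rewrite !mxE !eqxx oner_eq0.
pose a := gram_form S e0 e0; pose b := gram_form S e0 e1; pose c := gram_form S e1 e1.
(* x is a root of a x^2 + 2 b x + c, the value of the form on x e0 + e1. *)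
have [x xE] := solve_monicpoly (fun i => if i == 0 then - c / a else - (2%:R * b) / a)
  (isT : 0 < 2)%N.
move: xE; rewrite !big_ord_recl big_ord0 /= expr0 expr1 mulr1 addr0 => xE.
exists (x *: e0 + e1); split.
- by apply: cvparD => //; apply: cvparZ.
- apply/eqP => /matrixP/(_ i1 0)/eqP.
  by rewrite !mxE !eqxx /= mulr0 add0r oner_eq0.
rewrite !gramE (gram_sym Sf e0p e1p) mul1r -/a -/b -/c.
have -> : x * (x * a) = x ^+ 2 * a by ring.
by rewrite xE; move: (a0); rewrite -/a => a0'; field.
Qed.

Lemma osp_3_2 (S : 'M[K]_(3 + 2)) : super_form S ->
  H1_adjoint_eq0 (osp S) /\ H2_trivial_eq0 (osp S).
Proof.
move=> Sf; have [u1 [u1p u1n u11]] := isotropic_even Sf.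
have [u2 [u2p u22 u12]] := hyperbolic_partner Sf char2 u1p u1n u11.
have [z [zp zn zu1 zu2]] := @gram_kernel K 3 2 S false u1 u2 isT.
have [y [yp yu1 yu2 zy]] := hyperbolic_complement Sf u1p u2p zp u11 u22 u12 zn zu1 zu2.
(* Since G(z, y) != 0, polarization makes one of z, y, z + y anisotropic. *)
have [u0 [u0p u01 u02 u00]] : exists u0, [/\ cvpar false u0, gram_form S u0 u1 = 0,
    gram_form S u0 u2 = 0 & gram_form S u0 u0 != 0].
  have [zz|zz] := eqVneq (gram_form S z z) 0; last by exists z.
  have [yy|yy] := eqVneq (gram_form S y y) 0; last by exists y.
  exists (z + y); split; first exact: cvparD.
  - by rewrite !gramE zu1 yu1 addr0.
  - by rewrite !gramE zu2 yu2 addr0.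
  rewrite !gramE zz yy (gram_sym Sf zp yp) mul1r addr0 add0r -mulr2n -mulr_natr.
  by rewrite mulf_neq0.
pose i3 : 'I_(3 + 2) := rshift 3 (@ord0 1).
pose u3 : 'cV[K]_(3 + 2) := delta_mx i3 0.
have u3p : cvpar true u3 := @cvpar_delta K 3 2 i3.
have u3n : u3 != 0.
  by apply/eqP => /matrixP/(_ i3 0)/eqP; rewrite !mxE !eqxx oner_eq0.
have u33 := gram_odd Sf char2 u3p.
have [u4 [u4p u44 u34]] := hyperbolic_partner Sf char2 u3p u3n u33.
have eo v w : cvpar false v -> cvpar true w -> gram_form S v w = 0.
  by move=> v0 w1; apply: (gram_parity Sf v0 w1).
have oe v w : cvpar true v -> cvpar false w -> gram_form S v w = 0.
  by move=> v1 w0; apply: (gram_parity Sf v1 w0).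
have u10 : gram_form S u1 u0 = 0 by rewrite (gram_sym Sf u0p u1p) u01 mulr0.
have u20 : gram_form S u2 u0 = 0 by rewrite (gram_sym Sf u0p u2p) u02 mulr0.
have u21 : gram_form S u2 u1 != 0.
  by rewrite (gram_sym Sf u1p u2p) mulf_neq0 ?signr_eq0.
have u43 : gram_form S u4 u3 != 0.
  by rewrite (gram_sym Sf u3p u4p) mulf_neq0 ?signr_eq0.
apply: (@osp_cohomology_of_basis K 3 2 S Sf char2 pairing ord0 dvec
  (fun i => nth 0 [:: u0; u1; u2; u3; u4] i)) => //.
- exact: pairingK.
- move=> i; rewrite /idx_par pairingE.
  by have /eqP := @ord_all 5 (fun k => (3 <= nth 0 pairing_seq k) == (3 <= k))%N isT i.
- exact: pairing_fix.
- by case=> [[|[|[|[|[|//]]]]] ?].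
- case=> [[|[|[|[|[|//]]]]] ?]; case=> [[|[|[|[|[|//]]]]] ?];
    rewrite -val_eqE /= pairingE /= => *; first [done | by apply: eo | by apply: oe].
- by case=> [[|[|[|[|[|//]]]]] ?]; rewrite pairingE.
Qed.

Lemma osp_1_4 (S : 'M[K]_(1 + 4)) : super_form S ->
  H1_adjoint_eq0 (osp S) /\ H2_trivial_eq0 (osp S).
Proof.
move=> Sf; pose i0 : 'I_(1 + 4) := lshift 4 (@ord0 0).
pose u0 : 'cV[K]_(1 + 4) := delta_mx i0 0.
have u0p : cvpar false u0 := @cvpar_delta K 1 4 i0.
have delta_neq0 (i : 'I_(1 + 4)) : delta_mx i 0 != 0 :> 'cV[K]_(1 + 4).
  by apply/eqP => /matrixP/(_ i 0)/eqP; rewrite !mxE !eqxx oner_eq0.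
(* The basis vector pairing with u0 is even, hence u0 itself. *)
have u00 : gram_form S u0 u0 != 0.
  have [i ip] := gram_nondeg Sf u0p (delta_neq0 i0).
  suff -> : i = i0 by [].
  by apply: val_inj; case: i ip => [[|i] ?].
pose i1 : 'I_(1 + 4) := rshift 1 (@ord0 3).
pose u1 : 'cV[K]_(1 + 4) := delta_mx i1 0.
have u1p : cvpar true u1 := @cvpar_delta K 1 4 i1.
have odd0 x : cvpar true x -> gram_form S x x = 0 := gram_odd Sf char2 (x := x).
have u11 := odd0 _ u1p.
have [u2 [u2p u22 u12]] := hyperbolic_partner Sf char2 u1p (delta_neq0 i1) u11.
have [u3 [u3p u3n u31 u32]] := @gram_kernel K 1 4 S true u1 u2 isT.
have [u4 [u4p u41 u42 u34]] :=
  hyperbolic_complement Sf u1p u2p u3p u11 u22 u12 u3n u31 u32.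
have u33 := odd0 _ u3p; have u44 := odd0 _ u4p.
have eo v w : cvpar false v -> cvpar true w -> gram_form S v w = 0.
  by move=> v0 w1; apply: (gram_parity Sf v0 w1).
have oe v w : cvpar true v -> cvpar false w -> gram_form S v w = 0.
  by move=> v1 w0; apply: (gram_parity Sf v1 w0).
have u13 : gram_form S u1 u3 = 0 by rewrite (gram_sym Sf u3p u1p) u31 mulr0.
have u23 : gram_form S u2 u3 = 0 by rewrite (gram_sym Sf u3p u2p) u32 mulr0.
have u14 : gram_form S u1 u4 = 0 by rewrite (gram_sym Sf u4p u1p) u41 mulr0.
have u24 : gram_form S u2 u4 = 0 by rewrite (gram_sym Sf u4p u2p) u42 mulr0.
have u21 : gram_form S u2 u1 != 0.
  by rewrite (gram_sym Sf u1p u2p) mulf_neq0 ?signr_eq0.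
have u43 : gram_form S u4 u3 != 0.
  by rewrite (gram_sym Sf u3p u4p) mulf_neq0 ?signr_eq0.
apply: (@osp_cohomology_of_basis K 1 4 S Sf char2 pairing ord0 dvec
  (fun i => nth 0 [:: u0; u1; u2; u3; u4] i)) => //.
- exact: pairingK.
- move=> i; rewrite /idx_par pairingE.
  by have /eqP := @ord_all 5 (fun k => (1 <= nth 0 pairing_seq k) == (1 <= k))%N isT i.
- exact: pairing_fix.
- by case=> [[|[|[|[|[|//]]]]] ?].
- case=> [[|[|[|[|[|//]]]]] ?]; case=> [[|[|[|[|[|//]]]]] ?];
    rewrite -val_eqE /= pairingE /= => *; first [done | by apply: eo | by apply: oe].
- by case=> [[|[|[|[|[|//]]]]] ?]; rewrite pairingE.
Qed.

Lemma sl_1_2 : H1_adjoint_eq0 (sl K 1 2) /\ H2_trivial_eq0 (sl K 1 2).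
Proof.
have n12 : 1%:R != 2%:R :> K.
  by rewrite eq_sym -subr_eq0 -natrB // oner_eq0.
(* The diagonal entries are 1 + t | 1, t, with supertrace (1 + t) - 1 - t = 0. *)
pose a : seq int := [:: 1; 1; 0]; pose b : seq int := [:: 1; 0; 1].
pose d : 'rV[K]_(1 + 2) := weights t a b 3.
have dstr : supertrace (diag_mx d) = 0.
  rewrite /supertrace !big_ord_recl big_ord0 !mxE /=.
  ring.
have dgen (i j k l : 'I_(1 + 2)) : i != j ->
    d 0 k - d 0 l = d 0 i - d 0 j -> k = i /\ l = j.
  move=> ij E; have [//|//|/eqP ea /eqP eb] := @weights_eq K p charK p_gt3 t tp a b 3 i j k l _ _ E.
  pose P (i j k l : nat) := (i != j) ==> (a`_k - a`_l == a`_i - a`_j) ==>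
    (b`_k - b`_l == b`_i - b`_j) ==> ((k == i) && (l == j)).
  have PT : all (fun i => all (fun j => all (fun k => all (P i j k) (iota 0 3)) (iota 0 3))
    (iota 0 3)) (iota 0 3) by vm_compute.
  have := ord_all (ord_all (ord_all (ord_all PT i) j) k) l.
  rewrite /P (_ : (i != j :> nat) = true) ?ea ?eb //=.
  by case/andP=> /eqP ki /eqP lj; split; apply: val_inj.
by split; [apply: H1_sl n12 dstr dgen | apply: H2_sl n12 dstr dgen].
Qed.
End Main.

Theorem lemma2p14 (K : closedFieldType) (p : nat)
    (charK : p \in [pchar K]) (p_gt3 : (3 < p)%N) :
  [/\ H1_adjoint_eq0 (sl K 1 2) /\ H2_trivial_eq0 (sl K 1 2),
      forall S : 'M[K]_(3 + 2), super_form S ->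
        H1_adjoint_eq0 (osp S) /\ H2_trivial_eq0 (osp S)
    & forall S : 'M[K]_(1 + 4), super_form S ->
        H1_adjoint_eq0 (osp S) /\ H2_trivial_eq0 (osp S)].
Proof.
have [t tp] := artin_schreier_root charK p_gt3; split.
- exact: sl_1_2 charK p_gt3 _ tp.
- exact: osp_3_2 charK p_gt3 _ tp.
- exact: osp_1_4 charK p_gt3 _ tp.
Qed.
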